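(* Let $1 \le p < 2$ and $d = 2$. Then there exists a sequence of (nonzero) Schwartz functions $f_n \in X_2$ such that $$\lim_{n \to \infty} \frac{\|f_n\|_{p'}}{\|f_n\|_p} = \infty .$$
   Context: Norms are $L^p(\mathbb{R}^2)$ norms of complex-valued functions; $p'$ is the conjugate exponent, $\frac1p+\frac1{p'}=1$ (with $p'=\infty$ if $p=1$). The space $X_2$ consists of the functions in $L^1(\mathbb{R}^2)$ whose Fourier transforms vanish on all circles (centered at the origin) of radius $\sqrt{l^2+k^2}$ with $k,l$ integers: $$X_2 = \{ f \in L^1(\mathbb{R}^2) : \hat f(\mathbf{r}) = 0 \text{ whenever } |\mathbf{r}| = \sqrt{l^2+k^2} \text{ for some } (k,l) \in \mathbb{Z}^2 \},$$ where $\hat f(\xi) = \int_{\mathbb{R}^2} f(x) e^{-2\pi i x\cdot\xi}\,dx$. *)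

(* Defs.v *)
From mathcomp Require Import all_boot all_order all_algebra.
From mathcomp Require Import complex.
From mathcomp Require Import all_classical all_reals all_analysis.

Set Implicit Arguments.
Unset Strict Implicit.
Unset Printing Implicit Defensive.

Import Order.TTheory GRing.Theory Num.Theory.
Import numFieldNormedType.Exports.

Local Open Scope classical_set_scope.
Local Open Scope ring_scope.

Section Plane.
Variable R : realType.
Implicit Types (g : R * R -> R) (f : R * R -> R[i]).

Local Notation mu2 := (@lebesgue_measure R \x @lebesgue_measure R)%E.

Definition axis (i : bool) : R * R := if i then (0, 1) else (1, 0).

Definition partial (i : bool) g (x : R * R) : R :=
  'D_(axis i) g x.

(* A word over {false, true} encodes an iterated partial derivative, in the first
   (false) and second (true) coordinate. *)
Definition partials (s : seq bool) g : R * R -> R := foldr partial g s.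

Definition smooth g :=
  forall s : seq bool, continuous (partials s g) /\
    forall (i : bool) (x : R * R), derivable (partials s g) x (axis i).

Definition schwartzR g := smooth g /\
  forall (a b : nat) (s : seq bool), exists C : R, forall x : R * R,
    `|x.1 ^+ a * x.2 ^+ b * partials s g x| <= C.

(* Differentiability of a complex-valued function is meant over the reals, hence
   amounts to that of its real and imaginary parts. *)
Definition schwartz f :=
  schwartzR (fun x => complex.Re (f x)) /\ schwartzR (fun x => complex.Im (f x)).

Definition integrableC f :=
  mu2.-integrable setT (fun x => (complex.Re (f x))%:E) /\
  mu2.-integrable setT (fun x => (complex.Im (f x))%:E).

Definition integralC f : R[i] :=
  ((\int[mu2]_x complex.Re (f x)) +i* (\int[mu2]_x complex.Im (f x)))%C.

Definition expi (t : R) : R[i] := (cos t +i* sin t)%C.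

Definition dot (x y : R * R) : R := x.1 * y.1 + x.2 * y.2.

(* The library norm on the product R * R is the max norm. *)
Definition enorm (x : R * R) : R := Num.sqrt (dot x x).

Definition fourier f (xi : R * R) : R[i] :=
  integralC (fun x => f x * expi (- (2 * pi * dot x xi))).

Definition LnormC (p : \bar R) f : \bar R :=
  'N[mu2]_p[(fun x => (Normc.normc (f x))%:E)]%E.

Definition X2 : set (R * R -> R[i]) :=
  [set f | integrableC f /\
    forall (r : R * R) (k l : int),
      enorm r = Num.sqrt ((l ^+ 2 + k ^+ 2)%:~R) -> fourier f r = 0].

End Plane.

(* Main.v *)
Require Import Defs.
From mathcomp Require Import all_boot all_order all_algebra.
From mathcomp Require Import complex.
From mathcomp Require Import all_classical all_reals all_analysis.
From mathcomp Require Import cyclic measurable_realfun ess_sup_inf zify ring lra.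

(** Let S be the set of sums of two squares; the Fourier transform of the function
    sought must vanish on every circle |xi|^2 = n with n in S.  The construction rests
    on S being thin: for every s > 0 there are a modulus q and a q-periodic set A that
    contains S and has density at most s.

    Let c_k (k < q) be the coefficients of the exponential polynomial
    Phi(t) = sum_k c_k exp(2 pi i k t / q) that takes at the integers the values of the
    indicator of the complement of A.  The function f with Fourier transform
    exp(- pi eps |xi|^2) Phi(|xi|^2) then belongs to X_2.  It is the explicit finite sum
    of complex Gaussians c_k / w_k * exp(- pi |x|^2 / w_k), where
    w_k = eps - 2 i k / q, so it is a Schwartz function ([sieved_gauss]).

    Let eps tend to 0 with q fixed.  The term k = 0 is a genuine Gaussian of mass
    c_0 = 1 - density(A) concentrated on |x| <= sqrt eps: its L^p' norm has order
    eps^(-1/p), and as p < 2 its L^p norm, of order eps^(-1/p'), is negligible compared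
    with that.  The other terms spread over |x| <= eps^(-1/2) and are bounded
    independently of eps.  Their phases oscillate at distinct rates, so that they are
    almost orthogonal in L^2, and by Parseval on Z/q the square of the L^2 norm of their
    sum is about (sum_(k <> 0) |c_k|^2) / eps <= s / eps.  As this sum lives on a set of
    area 1 / eps, its L^p norm is at most a constant times sqrt s * eps^(-1/p).  Hence
    the quotient of the two norms of f is at least a constant over sqrt s
    ([sieved_gauss_ratio]), and s is arbitrary.

    Thinness of S comes from the primes p = 3 mod 4: none of them divides a sum of two
    squares exactly once, so sieving by finitely many of them leaves the density
    prod (1 - 1/p + 1/p^2).  That this product tends to 0 is proved without L-functions.
    Let U be the set of odd numbers without prime factor 3 mod 4, V the set of products
    of primes 3 mod 4, and chi the character mod 4.  The sum r(n) of chi over the divisors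
    of n is nonnegative, and it is the number of divisors of n for n in U.  The partial
    sums of chi(k)/k being at most 1, sum_(n < N) r(n)/n is at most sum_(n < N) 1/n; so
    (sum_(u in U, u < y) 1/u)^2 is at most sum_(n < y^2) 1/n, of order log y.  As every
    odd number is a product u v, it follows that sum_(v in V, v < y) 1/v has order at
    least sqrt (log y), which forces the product over p to 0.

    The Fourier transform of a complex Gaussian is found by solving two differential
    equations, one in the frequency and one in the imaginary part of the exponent; they
    come from differentiation under the integral sign and integration by parts. *)

Import Order.TTheory GRing.Theory Num.Theory.
Import numFieldNormedType.Exports.

Local Open Scope ring_scope.

(** * The character modulo 4 and its divisor sums *)

Definition chi4 (n : nat) : int :=
  if (n %% 4 == 1)%N then 1 else if (n %% 4 == 3)%N then -1 else 0.

Lemma chi4M m n : chi4 (m * n) = chi4 m * chi4 n.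
Proof.
rewrite /chi4 -modnMm.
have := ltn_pmod m (isT : 0 < 4)%N; have := ltn_pmod n (isT : 0 < 4)%N.
by case: (m %% 4)%N => [|[|[|[|//]]]]; case: (n %% 4)%N => [|[|[|[|//]]]].
Qed.

(** The nonzero terms alternate in sign and decrease, so no partial sum exceeds the
    first of them, which is 1. *)
Lemma chi4_sum_le1 (R : realFieldType) (K : nat) :
  \sum_(0 <= k < K) (chi4 k)%:~R / k%:R <= 1 :> R.
Proof.
pose s K : R := \sum_(0 <= k < K) (chi4 k)%:~R / k%:R.
have sS k : s k.+1 = s k + (chi4 k)%:~R / k%:R by rewrite /s big_nat_recr.
have chiE m j : chi4 (4 * m + j) = chi4 j.
  by rewrite /chi4 -modnDm modnMr add0n modn_mod.
have s2 m : s (4 * m + 2)%N = s (4 * m + 1)%N + (4 * m + 1)%:R^-1.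
  by rewrite addnS sS chiE /chi4 /= mulr1z mul1r.
have s3 m : s (4 * m + 3)%N = s (4 * m + 2)%N.
  by rewrite addnS sS chiE /chi4 /= mulr0z mul0r addr0.
have s4 m : s (4 * m + 4)%N = s (4 * m + 3)%N - (4 * m + 3)%:R^-1.
  by rewrite addnS sS chiE /chi4 /= mulrN1z mulN1r.
have s5 m : s (4 * m + 5)%N = s (4 * m + 4)%N.
  by rewrite addnS sS chiE /chi4 /= mulr0z mul0r addr0.
have s1 m : s (4 * m + 1)%N <= 1 - (4 * m + 1)%:R^-1.
  elim: m => [|m IH].
    by rewrite muln0 add0n sS /s big_geq // /chi4 /= mulr0z mul0r addr0 invr1 subrr.
  have -> : (4 * m.+1 + 1 = 4 * m + 5)%N by lia.
  rewrite s5 s4 s3 s2; move: IH; move: (4 * m)%N => k; rewrite !natrD.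
  have t0 : 0 <= k%:R :> R by rewrite ler0n.
  move: (k%:R : R) t0 => t t0 h.
  have h2 : (t + 5%:R)^-1 <= (t + 3%:R)^-1 by rewrite lef_pV2 ?posrE; lra.
  lra.
have Vge m : 0 <= (m%:R)^-1 :> R by rewrite invr_ge0 ler0n.
rewrite -/(s K) (divn_eq K 4) mulnC.
set m := (K %/ 4)%N; have := ltn_pmod K (isT : 0 < 4)%N.
have := s1 m; have := Vge (4 * m + 1)%N; have := s2 m; have := s3 m.
case: (K %% 4)%N => [|[|[|[|//]]]] e3 e2 h0 h1 _.
- rewrite addn0; case: (m) => [|k]; first by rewrite muln0 /s big_geq.
  have -> : (4 * k.+1 = 4 * k + 4)%N by lia.
  have := s1 k; have := s2 k; have := s3 k; have := s4 k.
  have := Vge (4 * k + 3)%N; lra.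
- lra.
- lra.
- lra.
Qed.

(** The primes 3 mod 4 are those that remain prime in the Gaussian integers. *)
Definition inert : nat_pred := [pred p | (p %% 4 == 3)%N].

(** Odd primes outside [inert] are 1 mod 4, and this is stable under products. *)
Lemma inert'_nat_mod4 n : odd n -> inert^'.-nat n -> (n %% 4 = 1)%N.
Proof.
elim/ltn_ind: n => n IH on pn.
have [n1|n1] := leqP n 1; first by case: n on n1 {IH pn} => [|[|]].
have pp := pdiv_prime n1; have dp := pdiv_dvd n.
have [m def] := dvdnP dp.
have m0 : (0 < m)%N by rewrite lt0n; apply: contraL on => /eqP m0; rewrite def m0.
have mn : (m < n)%N by rewrite [leqRHS]def ltn_Pmulr ?prime_gt1.
move: (on) (pn); rewrite def oddM pnatM => /andP[om op] /andP[pm ppi].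
have := IH _ mn om pm; rewrite -modnMm => ->.
move: ppi; rewrite pnatE // inE /= inE /=.
have := ltn_pmod (pdiv n) (isT : 0 < 4)%N.
move: op; rewrite (divn_eq (pdiv n) 4) oddD oddM andbF addFb -divn_eq.
by case: (pdiv n %% 4)%N => [|[|[|[|]]]].
Qed.

Lemma chi4_inert'_nat n d : odd n -> inert^'.-nat n -> (d %| n)%N -> chi4 d = 1.
Proof.
move=> on pn dn; rewrite /chi4 inert'_nat_mod4 ?(dvdn_odd dn) //.
by apply: pnat_dvd pn.
Qed.

Definition chi4_dvd_sum (n : nat) : int := \sum_(0 <= d < n.+1 | (d %| n)%N) chi4 d.

Lemma sum_dvd_bound (V : nmodType) n N (F : nat -> V) : (0 < n < N)%N ->
  \sum_(0 <= d < n.+1 | (d %| n)%N) F d = \sum_(0 <= d < N | (d %| n)%N) F d.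
Proof.
move=> /andP[n0 nN]; rewrite [RHS](big_cat_nat (n:=n.+1)) //=.
rewrite [X in _ = _ + X]big1_seq ?addr0 // => d /andP[/dvdn_leq -/(_ n0) dn].
rewrite mem_index_iota; lia.
Qed.

Lemma sum_multiples (V : nmodType) p N (Q : pred nat) (F : nat -> V) : (0 < p)%N ->
  \sum_(0 <= d < N | Q d && (p %| d)%N) F d =
  \sum_(0 <= e < N | Q (p * e)%N && (p * e < N)%N) F (p * e)%N.
Proof.
move=> p0.
transitivity (\sum_(0 <= d < N | Q d && (p %| d)%N)
    \sum_(0 <= e < N | (p * e == d)%N) F (p * e)%N).
  rewrite big_seq_cond [RHS]big_seq_cond; apply: eq_bigr => d /andP[]; rewrite mem_index_iota /=.
  move=> dN /andP[_ pd].
  rewrite (eq_bigl (fun e => true && (e == d %/ p)%N)) => [|e]; last first.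
    by rewrite -[in LHS](divnK pd) [(_ * p)%N]mulnC eqn_pmul2l.
  rewrite big_nat1_cond_eq (leq_ltn_trans (leq_div _ _) dN) /=.
  by rewrite mulnC divnK.
rewrite (exchange_big_dep_nat xpredT) //= [RHS]big_mkcond.
apply: eq_bigr => e _; under eq_bigl => d do rewrite eq_sym.
rewrite (eq_bigr (fun=> F (p * e)%N)) // big_nat1_cond_eq /=.
by rewrite dvdn_mulr // andbT andbC.
Qed.

(** Since chi4 p = -1, the divisors of n that are multiples of p contribute the opposite
    of the divisor sum of n / p; there remain the divisors prime to p. *)
Lemma chi4_dvd_sum_recursion p n : prime p -> (p %% 4 = 3)%N -> (0 < n)%N -> (p %| n)%N ->
  chi4_dvd_sum n + chi4_dvd_sum (n %/ p) = \sum_(0 <= d < n.+1 | (d %| n)%N && ~~ (p %| d)%N) chi4 d.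
Proof.
move=> pp p3 n0 pn; have p0 := prime_gt0 pp.
have m0 : (0 < n %/ p)%N by rewrite divn_gt0 // dvdn_leq.
have mn : (n %/ p <= n)%N by rewrite leq_div.
rewrite /chi4_dvd_sum (bigID (fun d => p %| d)%N) /= (@sum_dvd_bound _ (n %/ p) n.+1) ?m0 //.
rewrite addrAC -[RHS]add0r; congr (_ + _).
rewrite sum_multiples // [X in X + _](eq_bigl (fun e => e %| n %/ p)%N) => [|e].
  rewrite -big_split big1 //= => e _; rewrite chi4M {1}/chi4 p3 /= mulN1r.
  by rewrite addNr.
rewrite -{1}(divnK pn) mulnC dvdn_pmul2r // andb_idr // => /dvdn_leq -/(_ m0) le.
by rewrite ltnS -[leqRHS](divnK pn) leq_mul2r le orbT.
Qed.

(** By the recursion, the value at n plus the value at n / p depends only on the part of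
    n prime to p.  If p^2 divides n, the values at n and n / p^2 are therefore equal, and
    if p divides n exactly once the value at n is 0.  Once no prime 3 mod 4 divides n, all
    odd divisors are 1 mod 4 and no term is negative. *)
Lemma chi4_dvd_sum_ge0 n : (0 < n)%N -> 0 <= chi4_dvd_sum n.
Proof.
elim/ltn_ind: n => n IH n0.
have [/hasP[p]|] := boolP (has (mem inert) (primes n)).
  rewrite mem_primes => /and3P[pp _ pn] /=; rewrite !inE => /eqP p3.
  have p0 := prime_gt0 pp.
  have m0 : (0 < n %/ p)%N by rewrite divn_gt0 // dvdn_leq.
  have mn : (n %/ p < n)%N by rewrite ltn_Pdiv // prime_gt1.
  have Hn := chi4_dvd_sum_recursion _ _ pp p3 n0 pn.
  have E : \sum_(0 <= d < n.+1 | (d %| n)%N && ~~ (p %| d)%N) chi4 d =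
     \sum_(0 <= d < (n %/ p).+1 | (d %| n %/ p)%N && ~~ (p %| d)%N) chi4 d.
    rewrite [RHS](big_nat_widen _ _ n.+1) ?ltnS ?leq_div //.
    apply: eq_bigl => d /=.
    have [pd|pd] := boolP (p %| d)%N; first by rewrite !andbF.
    rewrite !andbT -{1}(divnK pn) Gauss_dvdl; last first.
      by rewrite coprime_sym prime_coprime.
    by rewrite andb_idr // => /dvdn_leq -/(_ m0); rewrite ltnS.
  have [pm|pm] := boolP (p %| n %/ p)%N.
    have Hm := chi4_dvd_sum_recursion _ _ pp p3 m0 pm.
    have m'0 : (0 < n %/ p %/ p)%N by rewrite divn_gt0 // dvdn_leq.
    have := IH (n %/ p %/ p)%N; rewrite (leq_ltn_trans (leq_div _ _) mn).
    move=> /(_ isT m'0); move: Hn Hm; rewrite E; lia.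
  suff : chi4_dvd_sum (n %/ p) = \sum_(0 <= d < (n %/ p).+1 | (d %| n %/ p)%N && ~~ (p %| d)%N) chi4 d.
    move: Hn; rewrite E; lia.
  apply: eq_bigl => d; rewrite andb_idr // => dm; apply: contraNN pm => pd.
  exact: dvdn_trans dm.
rewrite -all_predC => no3.
have pn : inert^'.-nat n by rewrite /pnat n0.
apply: sumr_ge0 => d dn; rewrite /chi4.
case: ifP => // _; case: ifP => // d3.
have od : odd d by rewrite (divn_eq d 4) (eqP d3) oddD oddM andbF.
have := pnat_dvd dn pn => /(inert'_nat_mod4 _ od) h; by rewrite h in d3.
Qed.

(** * Reciprocal sums over products of primes 3 mod 4 *)

(** The odd numbers whose prime factors all split in the Gaussian integers. *)
Definition split_odd (u : nat) := odd u && inert^'.-nat u.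

Lemma split_oddM u v : split_odd u -> split_odd v -> split_odd (u * v).
Proof. by rewrite /split_odd oddM pnatM => /andP[-> ->] /andP[-> ->]. Qed.

Lemma invrn_ge0 (R : realFieldType) m : 0 <= (m%:R)^-1 :> R.
Proof. by rewrite invr_ge0 ler0n. Qed.

Lemma ler_sum_nat_widen (R : realFieldType) (Y N : nat) (P Q : pred nat) (F : nat -> R) :
  (Y <= N)%N -> (forall i, (i < Y)%N -> P i -> Q i) -> (forall i, 0 <= F i) ->
  \sum_(0 <= i < Y | P i) F i <= \sum_(0 <= i < N | Q i) F i.
Proof.
move=> YN PQ F0; rewrite (big_nat_widen _ _ N) // [leLHS]big_mkcond [leRHS]big_mkcond.
apply: ler_sum => i _; case: ifP => [/andP[pi iY]|]; first by rewrite PQ.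
by case: ifP.
Qed.

(** An element n of the multiplicative set [split_odd] is a product of two elements at
    most as often as it has divisors, and the number of these is [chi4_dvd_sum] n because
    chi4 is 1 at each of them. *)
Lemma sum_split_oddX2_le_divisor_sum (R : realFieldType) (Y N : nat) : (N = Y ^ 2)%N ->
  (\sum_(0 <= u < Y | split_odd u) u%:R^-1) ^+ 2
    <= \sum_(0 <= n < N | split_odd n) (chi4_dvd_sum n)%:~R / n%:R :> R.
Proof.
move=> NE.
have YN : (Y <= N)%N by rewrite NE -mulnn; case: (Y) => // y; rewrite leq_pmulr.
have YY i j : (i < Y -> j < Y -> i * j < N)%N by move=> iY jY; rewrite NE -mulnn ltn_mul.
have -> : \sum_(0 <= n < N | split_odd n) (chi4_dvd_sum n)%:~R / n%:R =
   \sum_(0 <= n < N | split_odd n) \sum_(0 <= d < N | (d %| n)%N) n%:R^-1 :> R.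
  rewrite big_seq_cond [RHS]big_seq_cond; apply: eq_bigr => n /andP[]; rewrite mem_index_iota /=.
  move=> nN /andP[on pn]; have n0 := odd_gt0 on.
  rewrite /chi4_dvd_sum (@sum_dvd_bound _ n N) ?n0 //.
  rewrite (eq_bigr (fun=> 1)) => [|d dn]; last exact: (chi4_inert'_nat n).
  by rewrite rmorph_sum mulr_suml; apply: eq_bigr => d _; rewrite rmorph1 mul1r.
rewrite (exchange_big_dep_nat xpredT) //= expr2 mulr_suml.
apply: (@le_trans _ _ (\sum_(0 <= i < Y | split_odd i)
       \sum_(0 <= n < N | split_odd n && (i %| n)%N) n%:R^-1)); last first.
  by apply: ler_sum_nat_widen => // i; apply: sumr_ge0 => *; exact: invrn_ge0.
rewrite big_seq_cond [leRHS]big_seq_cond; apply: ler_sum => i /andP[].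
rewrite mem_index_iota /= => iY Ui; have i0 : (0 < i)%N by case/andP: Ui => /odd_gt0.
rewrite sum_multiples // mulr_sumr.
under eq_bigr => j _ do rewrite -invfM -natrM.
apply: ler_sum_nat_widen => [|j jY Uj|j]; last exact: invrn_ge0.
- exact: YN.
- by rewrite split_oddM //= YY.
Qed.

(** Write n = d * e and sum over d first: this leaves partial sums of chi4 d / d, which
    are at most 1. *)
Lemma sum_chi4_dvd_le (R : realFieldType) (N : nat) :
  \sum_(0 <= n < N | (0 < n)%N) (chi4_dvd_sum n)%:~R / n%:R <= \sum_(0 <= n < N) n%:R^-1 :> R.
Proof.
have -> : \sum_(0 <= n < N | (0 < n)%N) (chi4_dvd_sum n)%:~R / n%:R =
   \sum_(0 <= n < N | (0 < n)%N) \sum_(0 <= d < N | (d %| n)%N) (chi4 d)%:~R / n%:R :> R.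
  rewrite big_seq_cond [RHS]big_seq_cond; apply: eq_bigr => n /andP[].
  rewrite mem_index_iota /= => nN n0.
  by rewrite /chi4_dvd_sum (@sum_dvd_bound _ n N) ?n0 // rmorph_sum mulr_suml.
rewrite (exchange_big_dep_nat xpredT) //=.
have -> : \sum_(0 <= d < N) \sum_(0 <= n < N | (0 < n)%N && (d %| n)%N) (chi4 d)%:~R / n%:R
  = \sum_(0 <= d < N) \sum_(0 <= e < N | (d * e < N)%N) (e%:R^-1 * ((chi4 d)%:~R / d%:R)) :> R.
  apply: eq_bigr => -[|d] _.
    by rewrite [LHS]big1 ?[RHS]big1 // => i _; rewrite /chi4 /= mulr0z mul0r ?mulr0.
  rewrite sum_multiples // [LHS]big_mkcond [RHS]big_mkcond.
  apply: eq_bigr => -[|e] _ /=; first by rewrite !muln0 ltnn invr0 mul0r if_same.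
  by case: ifP => // _; rewrite natrM invfM mulrA [RHS]mulrC.
rewrite (exchange_big_dep_nat xpredT) //=; apply: ler_sum => -[|e] _.
  by rewrite invr0 big1 // => i _; rewrite mul0r.
rewrite -mulr_sumr ler_piMr ?invrn_ge0 //.
case: N => [|N]; first by rewrite big_geq.
have le : ((N %/ e.+1).+1 <= N.+1)%N by rewrite ltnS leq_div.
apply: le_trans (chi4_sum_le1 R (N %/ e.+1).+1).
rewrite [leRHS](big_nat_widen _ _ N.+1) // le_eqVlt; apply/orP; left; apply/eqP.
by apply: eq_bigl => d /=; rewrite !ltnS leq_divRL.
Qed.

Lemma sum_split_oddX2_le (R : realFieldType) (Y N : nat) : (N = Y ^ 2)%N ->
  (\sum_(0 <= u < Y | split_odd u) u%:R^-1) ^+ 2 <= \sum_(0 <= n < N) n%:R^-1 :> R.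
Proof.
move=> NE; apply: (le_trans (@sum_split_oddX2_le_divisor_sum R _ _ NE)).
apply: le_trans (@sum_chi4_dvd_le R N).
rewrite [leLHS]big_mkcond [leRHS]big_mkcond; apply: ler_sum => n _.
case: ifP => [/andP[/odd_gt0 -> //]|_]; case: ifP => // n0.
by rewrite mulr_ge0 ?invrn_ge0 ?ler0z ?chi4_dvd_sum_ge0.
Qed.

Lemma ler_sum_nat_term (R : realFieldType) (Y j : nat) (P : pred nat) (F : nat -> R) :
  (j < Y)%N -> P j -> (forall i, P i -> 0 <= F i) -> F j <= \sum_(0 <= i < Y | P i) F i.
Proof.
move=> jY Pj F0; rewrite big_mkcond (bigD1_seq j) ?mem_index_iota ?iota_uniq //= Pj.
by rewrite lerDl sumr_ge0 // => i _; case: ifP => // /F0.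
Qed.

(** An odd number is the product of its part at the primes 3 mod 4 and of its part at
    the other primes. *)
Lemma sum_odd_le (R : realFieldType) (Y : nat) :
  \sum_(0 <= n < Y | odd n) n%:R^-1 <=
  (\sum_(0 <= u < Y | split_odd u) u%:R^-1) * (\sum_(0 <= v < Y | inert.-nat v) v%:R^-1) :> R.
Proof.
rewrite mulr_suml; under [leRHS]eq_bigr => u _ do rewrite mulr_sumr.
apply: (@le_trans _ _ (\sum_(0 <= u < Y | split_odd u) \sum_(0 <= v < Y | inert.-nat v)
   \sum_(0 <= n < Y | odd n && (n == u * v)%N) n%:R^-1)); last first.
  apply: ler_sum => u _; apply: ler_sum => v _; rewrite big_nat1_cond_eq /=.
  case: ifP => _; last by rewrite mulr_ge0 ?invrn_ge0.
  by rewrite natrM invfM.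
rewrite [leRHS](eq_bigr (fun u => \sum_(0 <= n < Y | odd n)
  \sum_(0 <= v < Y | inert.-nat v && (odd n && (n == u * v)%N)) n%:R^-1)) => [|u _]; last first.
  by rewrite (exchange_big_dep_nat odd) //= => i j _ _ _ /andP[].
rewrite (exchange_big_dep_nat odd) //= big_seq_cond [leRHS]big_seq_cond.
apply: ler_sum => n /andP[]; rewrite mem_index_iota /= => nY on.
have n0 := odd_gt0 on.
have uY : (n`_inert^' < Y)%N by rewrite (leq_ltn_trans _ nY) // dvdn_leq // dvdn_part.
have vY : (n`_inert < Y)%N by rewrite (leq_ltn_trans _ nY) // dvdn_leq // dvdn_part.
have Uu : split_odd (n`_inert^')%N by rewrite /split_odd part_pnat andbT (dvdn_odd _ on) // dvdn_part.
apply: (@le_trans _ _ (\sum_(0 <= v < Y | inert.-nat v && (odd n && (n == (n`_inert^')%N * v)%N)) n%:R^-1)).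
  apply: (@ler_sum_nat_term R Y (n`_inert)%N
    (fun v => inert.-nat v && (odd n && (n == (n`_inert^')%N * v)%N)) (fun=> n%:R^-1)) => //.
  by rewrite part_pnat on mulnC partnC /=.
apply: (@ler_sum_nat_term R Y (n`_inert^')%N (fun u => split_odd u && odd n) (fun u =>
  \sum_(0 <= v < Y | inert.-nat v && (odd n && (n == u * v)%N)) n%:R^-1)) ; rewrite ?Uu ?on //.
by move=> i _; apply: sumr_ge0 => j _; exact: invrn_ge0.
Qed.

Lemma harmonic_pow2_le (R : realFieldType) j :
  \sum_(0 <= n < 2 ^ j) n%:R^-1 <= j%:R :> R.
Proof.
elim: j => [|j IH]; first by rewrite big_nat1 invr0.
have le2 : (2 ^ j <= 2 ^ j.+1)%N by rewrite leq_exp2l.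
rewrite (big_cat_nat (n:=2 ^ j)) //= -[in leRHS]natr1 lerD //.
apply: (@le_trans _ _ (\sum_(2 ^ j <= n < 2 ^ j.+1) (2 ^ j)%:R^-1)).
  rewrite !big_nat; apply: ler_sum => i /andP[ij _].
  by rewrite lef_pV2 ?posrE ?ltr0n ?ler_nat // ?expn_gt0 // (leq_trans _ ij) ?expn_gt0.
rewrite sumr_const_nat expnS mul2n -addnn addnK -[leLHS]mulr_natr.
by rewrite mulVf // pnatr_eq0 expn_eq0.
Qed.

Lemma harmonic_pow2_ge (R : realFieldType) j :
  j%:R / 2 <= \sum_(0 <= n < 2 ^ j) n%:R^-1 :> R.
Proof.
elim: j => [|j IH]; first by rewrite big_nat1 invr0 mul0r.
have le2 : (2 ^ j <= 2 ^ j.+1)%N by rewrite leq_exp2l.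
rewrite (big_cat_nat (n:=2 ^ j)) //= -[in leLHS]natr1 mulrDl lerD //.
apply: (@le_trans _ _ (\sum_(2 ^ j <= n < 2 ^ j.+1) (2 ^ j.+1)%:R^-1)); last first.
  rewrite !big_nat; apply: ler_sum => i /andP[ij i2].
  by rewrite lef_pV2 ?posrE ?ltr0n ?ler_nat ?(ltnW i2) // ?expn_gt0 // (leq_trans _ ij) ?expn_gt0.
rewrite sumr_const_nat expnS mul2n -addnn addnK addnn -mul2n -[leRHS]mulr_natr natrM invfM mul1r.
by rewrite -mulrA mulVf ?mulr1 // pnatr_eq0 expn_eq0.
Qed.

Lemma sum_odd_ge (R : realFieldType) j :
  j%:R / 4 <= \sum_(0 <= n < 2 ^ j.+1 | odd n) n%:R^-1 :> R.
Proof.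
have E m : \sum_(0 <= n < 2 * m | odd n) n%:R^-1 = \sum_(0 <= i < m) (2 * i).+1%:R^-1 :> R.
  elim: m => [|m IH]; first by rewrite muln0 !big_geq.
  rewrite mulnS addnC addn2 big_mkcond !big_nat_recr //= -big_mkcond IH.
  by rewrite mul2n odd_double /= addr0.
rewrite expnS E; apply: (@le_trans _ _ (\sum_(0 <= i < 2 ^ j) (2^-1 * i.+1%:R^-1))).
  rewrite -mulr_sumr -[leRHS]addr0.
  have -> : \sum_(0 <= i < 2 ^ j) i.+1%:R^-1 = \sum_(0 <= n < (2 ^ j).+1) n%:R^-1 :> R.
    by rewrite big_nat_recl // invr0 add0r.
  have := harmonic_pow2_ge R j; rewrite big_nat_recr //=.
  have := invrn_ge0 R (2 ^ j); lra.
apply: ler_sum => i _; rewrite -invfM -natrM lef_pV2 ?posrE ?ltr0n // ler_nat; lia.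
Qed.

(** Below 2 ^ (j + 1) the reciprocals of the odd numbers add up to at least j / 4, while
    the square of the sum over [split_odd] is at most 2 (j + 1); [sum_odd_le] compares
    the two. *)
Lemma sum_inert_nat_ge (R : realFieldType) j : (0 < j)%N ->
  j%:R / 64 <= (\sum_(0 <= v < 2 ^ j.+1 | inert.-nat v) v%:R^-1) ^+ 2 :> R.
Proof.
move=> j0.
set V := \sum_(_ <= v < _ | _) _.
pose U : R := \sum_(0 <= u < 2 ^ j.+1 | split_odd u) u%:R^-1.
have V0 : 0 <= V by apply: sumr_ge0 => *; exact: invrn_ge0.
have U0 : 0 <= U by apply: sumr_ge0 => *; exact: invrn_ge0.
have h1 : j%:R / 4 <= U * V by apply: (le_trans (sum_odd_ge R j)); exact: sum_odd_le.
have h2 : U ^+ 2 <= (j.+1 * 2)%:R.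
  apply: le_trans (harmonic_pow2_le R _); rewrite expnM; exact: sum_split_oddX2_le.
have h3 : (j%:R / 4) ^+ 2 <= U ^+ 2 * V ^+ 2.
  by rewrite -exprMn ler_pXn2r ?nnegrE ?mulr_ge0 ?invr_ge0 ?ler0n.
have h4 : U ^+ 2 <= 4 * j%:R.
  by apply: (le_trans h2); rewrite -natrM ler_nat; lia.
have jp : 0 < j%:R :> R by rewrite ltr0n.
have h5 : (j%:R / 4) ^+ 2 <= 4 * j%:R * V ^+ 2.
  by apply: (le_trans h3); rewrite ler_wpM2r // sqr_ge0.
have h6 : j%:R * (j%:R / 64) <= j%:R * V ^+ 2 by nra.
by rewrite ler_pM2l in h6.
Qed.

(** A (p :: P)-smooth number is either prime to p, hence P-smooth, or p times a
    (p :: P)-smooth number.  The reciprocal sums thus satisfy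
    S(p :: P) <= S(P) + S(p :: P) / p, which gives the bound by the Euler product without
    expanding the latter. *)
Lemma smooth_sum_le (R : realFieldType) (P : seq nat) (x : nat) : all prime P ->
  (\sum_(0 <= v < x | (0 < v)%N && all (mem P) (primes v)) v%:R^-1) *
   \prod_(p <- P) (1 - p%:R^-1) <= 1 :> R.
Proof.
elim: P => [_|p P IH /= /andP[pp Pp]].
  rewrite big_nil mulr1.
  have [x1|x1] := leqP x 1.
    rewrite big1_seq // => i /andP[/andP[i0 _]]; rewrite mem_index_iota; lia.
  rewrite (eq_bigl (fun v => true && (v == 1%N))) => [|v].
    by rewrite big_nat1_cond_eq x1 /= invr1.
  case: v => [|[|v]] //=; apply/negbTE; rewrite -has_predC; apply/hasP.
  exists (pdiv v.+2) => //; by rewrite mem_primes pdiv_prime // pdiv_dvd.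
pose S := fun Q : seq nat => \sum_(0 <= v < x | (0 < v)%N && all (mem Q) (primes v)) v%:R^-1 : R.
have pi : p%:R^-1 < 1 :> R by rewrite invf_lt1 ?ltr0n ?prime_gt0 // ltr1n prime_gt1.
have S0 Q : 0 <= S Q by apply: sumr_ge0 => *; exact: invrn_ge0.
suff key : S (p :: P) <= S P + p%:R^-1 * S (p :: P).
  rewrite big_cons mulrA -/(S _); apply: le_trans (IH Pp).
  rewrite ler_wpM2r //; last by rewrite -/(S _); lra.
  rewrite big_seq prodr_ge0 // => q qP.
  by have pq := allP Pp _ qP; rewrite subr_ge0 invf_le1 ?ler1n ?ltr0n ?prime_gt0.
rewrite {1}/S (bigID (fun v => p %| v)%N) /= addrC lerD //.
  rewrite big_mkcond [leRHS]big_mkcond; apply: ler_sum => v _.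
  case: ifP => [/andP[/andP[v0 /allP sm] pv]|_]; last by case: ifP => // _; exact: invrn_ge0.
  suff -> : all (mem P) (primes v) by rewrite v0.
  apply/allP => q qv; have := sm _ qv; rewrite inE => /orP[/eqP qp|//].
  by move: qv; rewrite qp mem_primes => /and3P[_ _]; rewrite (negbTE pv).
have p0 := prime_gt0 pp.
rewrite sum_multiples // mulr_sumr big_mkcond [leRHS]big_mkcond; apply: ler_sum => v _.
case: ifP => [/andP[/andP[pv0 /allP sm] _]|_]; last first.
  by case: ifP => // _; rewrite mulr_ge0 ?invrn_ge0.
move: pv0; rewrite muln_gt0 => /andP[_ v0].
suff -> : all (mem (p :: P)) (primes v) by rewrite v0 natrM invfM.
apply/allP => q; rewrite mem_primes => /and3P[pq _ qv]; apply: sm.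
by rewrite mem_primes pq muln_gt0 p0 v0 dvdn_mull.
Qed.

(** * Sieving the sums of two squares *)

Definition exactly_dvd (p n : nat) := (p %| n)%N && ~~ (p ^ 2 %| n)%N.
Definition sieve (P : seq nat) (n : nat) := all (fun p => ~~ exactly_dvd p n) P.

Lemma dvdn_addX_odd x y k : odd k -> (x + y %| x ^ k + y ^ k)%N.
Proof.
move=> ok; rewrite -(odd_double_half k) ok add1n.
elim: (k./2) => [|m IH]; first by rewrite !expn1.
rewrite doubleS; set j := m.*2 in IH *.
rewrite -(dvdn_addl _ (dvdn_mull (x * y) IH)).
have -> : (x ^ j.+3 + y ^ j.+3 + x * y * (x ^ j.+1 + y ^ j.+1) =
  (x + y) * (x ^ j.+2 + y ^ j.+2))%N by rewrite !expnS; ring.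
exact: dvdn_mulr.
Qed.

(** Since (p - 1) / 2 is odd, a^2 + b^2 divides a^(p-1) + b^(p-1), which by Fermat is
    2 mod p when p divides neither a nor b. *)
Lemma inert_dvd_sum2 p a b : prime p -> (p %% 4 = 3)%N -> (p %| a ^ 2 + b ^ 2)%N -> (p %| a)%N.
Proof.
move=> pp p3 pab; apply/idPn => pa.
have pb : ~~ (p %| b)%N.
  apply: contra pa => pb; move: pab; rewrite dvdn_addl; last by rewrite -mulnn dvdn_mulr.
  by rewrite Euclid_dvdX // => /andP[].
have := dvdn_trans pab (@dvdn_addX_odd (a ^ 2) (b ^ 2) (p %/ 2) _).
have -> : odd (p %/ 2) by rewrite (divn_eq p 4) p3; lia.
move=> /(_ isT); rewrite -!expnM.
have -> : (2 * (p %/ 2) = totient p)%N by rewrite totient_prime //; lia.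
rewrite /dvdn -modnDm !Euler_exp_totient ?[coprime _ p]coprime_sym ?prime_coprime //.
rewrite modnDm modn_small //; lia.
Qed.

(** A prime 3 mod 4 that divides a^2 + b^2 divides a and b, so its square divides the sum
    as well. *)
Lemma sieve_sum2 P a b : all prime P -> all (mem inert) P -> sieve P (a ^ 2 + b ^ 2)%N.
Proof.
move=> /allP Pp /allP P3; apply/allP => p pP.
have pp := Pp _ pP; have /eqP p3 := P3 _ pP.
rewrite /exactly_dvd negb_and negbK; have [pab|//] := boolP (p %| _)%N.
have pa := inert_dvd_sum2 _ _ _ pp p3 pab.
have pb : (p %| b)%N by apply: (@inert_dvd_sum2 _ b a); rewrite // addnC.
by rewrite dvdn_add // dvdn_exp2r.
Qed.

Definition sieve_modulus (P : seq nat) := (\prod_(p <- P) p ^ 2)%N.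

(** Each pair of residues comes from exactly one n, by the Chinese remainder theorem. *)
Lemma count_crt (m1 m2 : nat) (a b : pred nat) : (0 < m1)%N -> (0 < m2)%N -> coprime m1 m2 ->
  (\sum_(0 <= n < m1 * m2 | a (n %% m1) && b (n %% m2)) 1 =
   (\sum_(0 <= i < m1 | a i) 1) * (\sum_(0 <= j < m2 | b j) 1))%N.
Proof.
move=> m10 m20 co.
rewrite [RHS]big_distrl /=; under [RHS]eq_bigr => i _ do rewrite mul1n.
transitivity (\sum_(0 <= i < m1 | a i) \sum_(0 <= j < m2 | b j)
  \sum_(0 <= n < m1 * m2 | (a (n %% m1) && b (n %% m2)) && ((n %% m1 == i) && (n %% m2 == j))) 1)%N.
  under [RHS]eq_bigr => i _.
    rewrite (exchange_big_dep_nat (fun n => a (n %% m1) && b (n %% m2))%N) //=; last by move=> ? ? _ _ _ /andP[].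
    over.
  rewrite (exchange_big_dep_nat (fun n => a (n %% m1) && b (n %% m2))%N) //=.
  apply: eq_bigr => n /andP[an bn].
  rewrite big_mkcond (bigD1_seq (n %% m1)%N) ?mem_index_iota ?iota_uniq ?ltn_pmod //= an.
  rewrite [X in (_ + X)%N]big1 ?addn0 => [|i ne]; last first.
    case: ifP => // _.
    by rewrite big_pred0 // => j; apply/negP => /and4P[_ _ /eqP e]; rewrite e eqxx in ne.
  rewrite bn /= (eq_bigl (fun j => true && (j == n %% m2)%N)) => [|j].
    by rewrite big_nat1_cond_eq ltn_pmod.
  by rewrite eqxx /= eq_sym; case: eqP => [->|]; rewrite ?bn ?andbF.
rewrite big_seq_cond [RHS]big_seq_cond; apply: eq_bigr => i /andP[].
rewrite mem_index_iota => /= im ai.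
rewrite big_seq_cond [RHS]big_seq_cond; apply: eq_bigr => j /andP[].
rewrite mem_index_iota => /= jm bj.
pose c := (chinese m1 m2 i j %% (m1 * m2))%N.
transitivity (\sum_(0 <= n < m1 * m2 | true && (n == c)) 1)%N; last first.
  by rewrite big_nat1_cond_eq ltn_pmod ?muln_gt0 ?m10.
rewrite big_seq_cond [RHS]big_seq_cond; apply: eq_bigl => n; rewrite mem_index_iota /=.
case: ltnP => //= nlt; have -> : (n == c) = (n %% m1 == i)%N && (n %% m2 == j)%N.
  rewrite /c -{1}(modn_small nlt) (chinese_remainder co).
  by rewrite chinese_modl // chinese_modr // (modn_small im) (modn_small jm).
by case: eqP => [->|]; case: eqP => [->|]; rewrite ?andbF // ai bj.
Qed.

Lemma count_not_exactly_dvd p : prime p -> (\sum_(0 <= i < p ^ 2 | ~~ exactly_dvd p i) 1 = p ^ 2 - p + 1)%N.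
Proof.
move=> pp; have p0 := prime_gt0 pp; have p2 : (p <= p ^ 2)%N by rewrite -mulnn leq_pmulr.
have : (\sum_(0 <= i < p ^ 2) 1 = p ^ 2)%N by rewrite sum_nat_const_nat subn0 muln1.
rewrite (bigID (exactly_dvd p)) /=.
suff -> : (\sum_(0 <= i < p ^ 2 | exactly_dvd p i) 1 = p - 1)%N by lia.
rewrite (eq_bigl (fun i => ~~ (p ^ 2 %| i) && (p %| i))%N) => [|i]; last exact: andbC.
rewrite sum_multiples //.
rewrite (eq_bigl (fun e => (0 < e) && (e < p))%N) => [|e]; last first.
  rewrite -mulnn dvdn_pmul2l // ltn_pmul2l //.
  have [ep|] := ltnP e p; rewrite ?andbF // !andbT.
  case: e ep => [|e] ep; first by rewrite dvdn0.
  by rewrite gtnNdvd.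
rewrite -(big_nat_widen _ _ _ (fun e => 0 < e)%N) //.
case: (p) p0 => // q _; rewrite big_mkcond big_nat_recl //= ?add0n ?add0r sum_nat_const_nat; lia.
Qed.

Lemma sieve_mod P m n : (sieve_modulus P %| m)%N -> sieve P (n %% m) = sieve P n.
Proof.
rewrite /sieve_modulus => Pm; apply: eq_in_all => p pP; rewrite /exactly_dvd.
have p2m : (p ^ 2 %| m)%N by apply: dvdn_trans Pm; rewrite (big_rem p) //= dvdn_mulr.
by rewrite /dvdn !modn_dvdm // (dvdn_trans _ p2m) // -mulnn dvdn_mulr.
Qed.

Lemma sieve_modulus_gt0 P : all prime P -> (0 < sieve_modulus P)%N.
Proof.
move=> Pp; rewrite /sieve_modulus big_seq; apply: prodn_cond_gt0 => p pP.
by rewrite expn_gt0 prime_gt0 // (allP Pp).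
Qed.

Lemma count_sieve P : uniq P -> all prime P ->
  (\sum_(0 <= n < sieve_modulus P | sieve P n) 1 = \prod_(p <- P) (p ^ 2 - p + 1))%N.
Proof.
elim: P => [_ _|p P IH /andP[pP uP] /andP[pp Pp]].
  by rewrite /sieve_modulus !big_nil big_mkcond big_nat1.
have mE : sieve_modulus (p :: P) = (p ^ 2 * sieve_modulus P)%N by rewrite /sieve_modulus big_cons.
have co : coprime (p ^ 2) (sieve_modulus P).
  rewrite coprimeXl // /sieve_modulus big_seq; apply: (big_ind (fun m => coprime p m)) => [|a b ca cb|r rP].
  - exact: coprimen1.
  - by rewrite coprimeMr ca.
  - rewrite coprimeXr // prime_coprime // dvdn_prime2 //; last exact: (allP Pp).
    by apply: contraNneq pP => ->.
rewrite mE big_cons -(count_not_exactly_dvd _ pp) -IH // -count_crt //; first last.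
- exact: sieve_modulus_gt0.
- by rewrite expn_gt0 prime_gt0.
apply: eq_bigl => n; rewrite sieve_mod //.
have := sieve_mod [:: p] (p ^ 2) n; rewrite /sieve_modulus big_seq1 dvdnn => /(_ isT).
by rewrite /sieve /= !andbT => ->.
Qed.

(** The prime p contributes the factor 1 - t + t^2 with t = 1 / p, and
    (1 - t + t^2)^2 <= 1 - t for t <= 1 / 3.  So the square of the density is at most the
    product of the 1 - 1 / p, which by [smooth_sum_le] is at most the inverse of a
    reciprocal sum that is unbounded by [sum_inert_nat_ge]. *)
Lemma sieve_small (R : archiRealFieldType) (s : R) : 0 < s ->
  exists P, [/\ uniq P, all prime P, all (mem inert) P &
    (\prod_(p <- P) (p ^ 2 - p + 1))%:R <= s * (sieve_modulus P)%:R].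
Proof.
move=> s0.
pose j := (Num.bound (64 / s ^+ 4)).+1.
have s40 : 0 < s ^+ 4 by rewrite exprn_gt0.
have hj : 64 / s ^+ 4 <= j%:R.
  apply: ltW; apply: lt_le_trans (archi_boundP _) _; first by rewrite divr_ge0 // ltW.
  by rewrite ler_nat.
(* j is large enough for the reciprocal sum below 2 ^ (j + 1) to exceed 1 / s^2 *)
pose x := (2 ^ j.+1)%N.
pose P := [seq p <- iota 0 x | prime p && (p \in inert)].
have Pp : all prime P by apply/allP => p; rewrite mem_filter => /andP[/andP[]].
have P3 : all (mem inert) P by apply/allP => p; rewrite mem_filter => /andP[/andP[]].
exists P; split => //; first by rewrite filter_uniq // iota_uniq.
have /(smooth_sum_le R _ x) := Pp.
have /(sum_inert_nat_ge R) : (0 < j)%N by [].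
rewrite -/x; set V := \sum_(_ <= v < _ | _) _; set V' := \sum_(_ <= v < _ | _) _ => hV hP.
have V0 : 0 <= V by apply: sumr_ge0 => *; exact: invrn_ge0.
have VV : V <= V'.
  rewrite /V /V' big_seq_cond [leRHS]big_seq_cond [leLHS]big_mkcond [leRHS]big_mkcond; apply: ler_sum => v _.
  case: ifP => [/andP[]|_]; last by case: ifP => // _; exact: invrn_ge0.
  rewrite mem_index_iota /= => vx /andP[v0 /allP pv].
  rewrite vx v0 /=.
  suff -> : all (mem P) (primes v) by [].
  apply/allP => p ppv; rewrite inE mem_filter (pv _ ppv) andbT mem_iota /= add0n.
  move: ppv; rewrite mem_primes => /and3P[-> _ /dvdn_leq -/(_ v0) pv'].
  exact: leq_ltn_trans vx.
have c1 p : p \in P -> [/\ 0 <= 1 - p%:R^-1 :> R, 0 < p%:R :> R &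
    (((p ^ 2 - p + 1)%:R / (p ^ 2)%:R) ^+ 2 <= 1 - p%:R^-1 :> R)].
  rewrite mem_filter => /andP[/andP[pp p3] _].
  have p3' : (3 <= p)%N by move: p3; rewrite inE /= => /eqP; lia.
  have pR : 3 <= p%:R :> R by rewrite ler_nat.
  rewrite natrD natrB ?natrX; last by rewrite -mulnn leq_pmulr // prime_gt0.
  have p0 : 0 < p%:R :> R by lra.
  have -> : (p%:R ^+ 2 - p%:R + 1) / p%:R ^+ 2 = 1 - p%:R^-1 + p%:R^-1 ^+ 2 :> R.
    by field; rewrite gt_eqF.
  have t3 : p%:R^-1 <= 3^-1 :> R by rewrite lef_pV2 ?posrE.
  have t0 : 0 < p%:R^-1 :> R by rewrite invr_gt0.
  move: (p%:R^-1 : R) t3 t0 => t t3 t0; split => //; first by lra.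
  nra.
set D : R := \prod_(p <- P) (1 - p%:R^-1) in hP.
pose r : R := \prod_(p <- P) ((p ^ 2 - p + 1)%:R / (p ^ 2)%:R).
have r0 : 0 <= r by apply: prodr_ge0 => *; rewrite divr_ge0 ?ler0n.
have rD : r ^+ 2 <= D.
  rewrite /r -prodrXl /D big_seq [leRHS]big_seq; apply: ler_prod => p pP.
  by have [_ _ ->] := c1 _ pP; rewrite sqr_ge0.
have D0 : 0 <= D by rewrite (le_trans _ rD) // sqr_ge0.
have rV : r ^+ 2 * V <= 1 by apply: le_trans hP; rewrite mulrC ler_pM ?sqr_ge0.
have rs : r <= s.
  have : (r ^+ 2 * V) ^+ 2 <= 1 by rewrite expr_le1 // mulr_ge0 // sqr_ge0.
  rewrite exprMn -exprM => r4.
  have : r ^+ 4 * (j%:R / 64) <= 1 by apply: le_trans r4; rewrite ler_wpM2l // exprn_ge0.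
  rewrite leNgt => r4j; rewrite leNgt; apply/negP => sr; move: r4j; apply/negP; rewrite negbK.
  have : s ^+ 4 < r ^+ 4 by rewrite ltrXn2r // ltW.
  move: hj; rewrite ler_pdivrMr //; nra.
have -> : (sieve_modulus P)%:R = \prod_(p <- P) (p ^ 2)%:R :> R by rewrite /sieve_modulus natr_prod.
rewrite natr_prod.
suff -> : \prod_(p <- P) (p ^ 2 - p + 1)%:R = r * \prod_(p <- P) (p ^ 2)%:R :> R.
  by rewrite ler_wpM2r // prodr_ge0.
rewrite /r -big_split big_seq [RHS]big_seq /=; apply: eq_bigr => p pP.
have [_ pp _] := c1 _ pP; rewrite divfK // natrX expf_neq0 // gt_eqF //.
Qed.

Theorem periodic_sieve (R : archiRealFieldType) (s : R) : 0 < s ->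
  exists (q : nat) (A : pred nat), [/\ (0 < q)%N,
    forall n, A (n %% q)%N = A n,
    forall a b, A (a ^ 2 + b ^ 2)%N &
    (\sum_(0 <= n < q | A n) 1)%:R <= s * q%:R].
Proof.
move=> /sieve_small[P [uP Pp P3 h]]; exists (sieve_modulus P), (sieve P); split.
- exact: sieve_modulus_gt0.
- by move=> n; rewrite sieve_mod.
- by move=> a b; apply: sieve_sum2.
- by rewrite count_sieve.
Qed.

Local Open Scope classical_set_scope.
Local Open Scope ring_scope.
Set Implicit Arguments.
Unset Strict Implicit.
Unset Printing Implicit Defensive.

(** * The complex exponential and componentwise differentiation *)

Section Cexp.
Variable R : realType.
Local Notation Re := (@complex.Re R).
Local Notation Im := (@complex.Im R).
Implicit Types z w : R[i].

Definition cexp (z : R[i]) : R[i] :=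
  (expR (Re z) * cos (Im z) +i* (expR (Re z) * sin (Im z)))%C.

Lemma cReD z w : Re (z + w) = Re z + Re w. Proof. by case: z; case: w. Qed.
Lemma cImD z w : Im (z + w) = Im z + Im w. Proof. by case: z; case: w. Qed.
Lemma cReN z : Re (- z) = - Re z. Proof. by case: z. Qed.
Lemma cImN z : Im (- z) = - Im z. Proof. by case: z. Qed.
Lemma cReM z w : Re (z * w) = Re z * Re w - Im z * Im w. Proof. by case: z; case: w. Qed.
Lemma cImM z w : Im (z * w) = Re z * Im w + Im z * Re w.
Proof. by case: z => a b; case: w => c d /=; rewrite addrC. Qed.
Lemma Re_sum I (r : seq I) (P : pred I) (F : I -> R[i]) :
  Re (\sum_(i <- r | P i) F i) = \sum_(i <- r | P i) Re (F i).
Proof. by apply: (big_morph Re cReD). Qed.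
Lemma Im_sum I (r : seq I) (P : pred I) (F : I -> R[i]) :
  Im (\sum_(i <- r | P i) F i) = \sum_(i <- r | P i) Im (F i).
Proof. by apply: (big_morph Im cImD). Qed.

Lemma complexP z w : Re z = Re w -> Im z = Im w -> z = w.
Proof. by case: z => a b; case: w => c d /= -> ->. Qed.

Lemma cexpD z w : cexp (z + w) = cexp z * cexp w.
Proof.
apply: complexP; rewrite ?cReM ?cImM /= cReD cImD expRD ?cosD ?sinD; ring.
Qed.

Lemma cexp0 : cexp 0 = 1.
Proof. by apply: complexP; rewrite /= expR0 ?cos0 ?sin0 ?mulr1 ?mulr0. Qed.

Lemma cexpN z : cexp (- z) * cexp z = 1.
Proof. by rewrite -cexpD addNr cexp0. Qed.

Lemma cexp_neq0 z : cexp z != 0.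
Proof.
apply/eqP => e; have := cexpN z; rewrite e mulr0 => /eqP.
by rewrite eq_sym oner_eq0.
Qed.

Lemma expiE t : expi t = cexp (0 +i* t)%C.
Proof. by rewrite /expi /cexp /= expR0 !mul1r. Qed.

Lemma normcRI z : Normc.normc z = Num.sqrt (Re z ^+ 2 + Im z ^+ 2).
Proof. by case: z. Qed.

Lemma normc_cexp z : Normc.normc (cexp z) = expR (Re z).
Proof.
rewrite normcRI /= !exprMn -mulrDr cos2Dsin2 mulr1 sqrtr_sqr ger0_norm ?expR_ge0 //.
Qed.

Lemma normc_Re z : `|Re z| <= Normc.normc z.
Proof.
by rewrite normcRI -[leLHS]sqrtr_sqr ler_wsqrtr // lerDl sqr_ge0.
Qed.

Lemma normc_Im z : `|Im z| <= Normc.normc z.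
Proof.
by rewrite normcRI -[leLHS]sqrtr_sqr ler_wsqrtr // lerDr sqr_ge0.
Qed.

Lemma normcM z w : Normc.normc (z * w) = Normc.normc z * Normc.normc w.
Proof. exact: Normc.normcM. Qed.

Lemma ler_normcD z w : Normc.normc (z + w) <= Normc.normc z + Normc.normc w.
Proof. exact: le_normcD. Qed.

Lemma normc_ge0 (z : R[i]) : 0 <= Normc.normc z.
Proof. by rewrite normcRI sqrtr_ge0. Qed.

Lemma normc_sqr (z : R[i]) : (Normc.normc z ^+ 2)%:C%C = z * z^*%C.
Proof.
rewrite normcRI sqr_sqrtr ?addr_ge0 ?sqr_ge0 //.
by case: z => a b; apply: complexP; rewrite ?cReM ?cImM /=; ring.
Qed.

Lemma normc_conj (z : R[i]) : Normc.normc z^*%C = Normc.normc z.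
Proof. by rewrite !normcRI; case: z => a b /=; rewrite sqrrN. Qed.

Lemma normc_sum (I : Type) (r : seq I) (F : I -> R[i]) :
  Normc.normc (\sum_(i <- r) F i) <= \sum_(i <- r) Normc.normc (F i).
Proof.
elim: r => [|i r IH]; first by rewrite !big_nil Normc.normc0.
by rewrite !big_cons (le_trans (ler_normcD _ _)) // lerD2l.
Qed.

(** Complex-valued functions of a real variable are differentiated componentwise, so that
    real calculus applies to each component. *)
Definition Cderive (g : R -> R[i]) (t : R) (D : R[i]) : Prop :=
  is_derive t 1 (Re \o g) (Re D) /\ is_derive t 1 (Im \o g) (Im D).

Lemma Cderive_eq g t D D' : Cderive g t D -> D = D' -> Cderive g t D'.
Proof. by move=> h <-. Qed.

Lemma Cderive_cst c t : Cderive (fun=> c) t 0.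
Proof. by split; exact: is_derive_cst. Qed.

Lemma CderiveM f g t df dg : Cderive f t df -> Cderive g t dg ->
  Cderive (fun x => f x * g x) t (df * g t + f t * dg).
Proof.
move=> [f1 f2] [g1 g2]; split.
  rewrite (_ : _ \o _ = (Re \o f) * (Re \o g) - (Im \o f) * (Im \o g)); last first.
    by apply/funext => x; rewrite /= cReM.
  apply: is_derive_eq; rewrite /GRing.scale /= cReD !cReM; ring.
rewrite (_ : _ \o _ = (Re \o f) * (Im \o g) + (Im \o f) * (Re \o g)); last first.
  by apply/funext => x; rewrite /= cImM.
apply: is_derive_eq; rewrite /GRing.scale /= cImD !cImM; ring.
Qed.

Lemma CderiveZ c f t df : Cderive f t df -> Cderive (fun x => c * f x) t (c * df).
Proof.
move=> h; apply: Cderive_eq; first exact: CderiveM (Cderive_cst c t) h.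
by rewrite mul0r add0r.
Qed.

Lemma Cderive_real (f : R -> R) (t df : R) : is_derive t 1 f df ->
  Cderive (fun x => (f x)%:C%C) t (df%:C)%C.
Proof. by move=> h; split => //=; exact: is_derive_cst. Qed.

Lemma Cderive_cexp g t D : Cderive g t D ->
  Cderive (fun x => cexp (g x)) t (D * cexp (g t)).
Proof.
move=> [g1 g2].
have he : is_derive t 1 (fun x => expR (Re (g x))) (Re D * expR (Re (g t))).
  apply: (is_derive_eq (@is_derive1_comp R expR (Re \o g) t _ _ (is_derive_expR _) g1)).
  by rewrite mulrC.
have hc : is_derive t 1 (fun x => cos (Im (g x))) (- Im D * sin (Im (g t))).
  apply: (is_derive_eq (@is_derive1_comp R cos (Im \o g) t _ _ (is_derive_cos _) g2)).
  by rewrite mulNr mulrC mulNr.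
have hs : is_derive t 1 (fun x => sin (Im (g x))) (Im D * cos (Im (g t))).
  apply: (is_derive_eq (@is_derive1_comp R sin (Im \o g) t _ _ (is_derive_sin _) g2)).
  by rewrite mulrC.
split.
  rewrite (_ : _ \o _ = (fun x => expR (Re (g x))) * (fun x => cos (Im (g x)))) //.
  apply: is_derive_eq; rewrite /GRing.scale /= cReM /=; ring.
rewrite (_ : _ \o _ = (fun x => expR (Re (g x))) * (fun x => sin (Im (g x)))) //.
apply: is_derive_eq; rewrite /GRing.scale /= cImM /=; ring.
Qed.

Lemma Cderive0_cst g : (forall t, Cderive g t 0) -> forall x y, g x = g y.
Proof.
move=> h x y; apply: complexP.
  by apply: (is_derive_0_is_cst (f := Re \o g)) => t; case: (h t).
by apply: (is_derive_0_is_cst (f := Im \o g)) => t; case: (h t).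
Qed.
End Cexp.

(** * Componentwise integration and real Gaussian integrals *)

Section Cint.
Context {d : measure_display} {T : measurableType d} {R : realType}.
Variable mu : {measure set T -> \bar R}.
Local Notation Re := (@complex.Re R).
Local Notation Im := (@complex.Im R).
Implicit Types f g : T -> R[i].

Definition Cintegrable f :=
  mu.-integrable setT (fun x => (Re (f x))%:E) /\
  mu.-integrable setT (fun x => (Im (f x))%:E).

Definition Cint f : R[i] := ((\int[mu]_x Re (f x)) +i* (\int[mu]_x Im (f x)))%C.

Lemma RintegrableZl (k : R) (f : T -> R) : mu.-integrable setT (fun x => (f x)%:E) ->
  mu.-integrable setT (fun x => (k * f x)%:E).
Proof. by move=> h; under eq_fun do rewrite EFinM; exact: integrableZl. Qed.

Lemma RintegrableD (f g : T -> R) : mu.-integrable setT (fun x => (f x)%:E) ->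
  mu.-integrable setT (fun x => (g x)%:E) -> mu.-integrable setT (fun x => (f x + g x)%:E).
Proof. by move=> hf hg; under eq_fun do rewrite EFinD; exact: integrableD. Qed.

Lemma RintegrableB (f g : T -> R) : mu.-integrable setT (fun x => (f x)%:E) ->
  mu.-integrable setT (fun x => (g x)%:E) -> mu.-integrable setT (fun x => (f x - g x)%:E).
Proof. by move=> hf hg; under eq_fun do rewrite EFinB; exact: integrableB. Qed.

Lemma CintegrableD f g : Cintegrable f -> Cintegrable g -> Cintegrable (fun x => f x + g x).
Proof.
move=> [f1 f2] [g1 g2]; split.
  by under eq_fun do rewrite cReD; exact: RintegrableD.
by under eq_fun do rewrite cImD; exact: RintegrableD.
Qed.

Lemma CintegrableZ c f : Cintegrable f -> Cintegrable (fun x => c * f x).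
Proof.
move=> [f1 f2]; split.
  by under eq_fun do rewrite cReM; apply: RintegrableB; exact: RintegrableZl.
by under eq_fun do rewrite cImM; apply: RintegrableD; exact: RintegrableZl.
Qed.

Lemma Cintegrable0 : Cintegrable (fun=> 0).
Proof. by split; exact: integrable0. Qed.

Lemma Cintegrable_sum (I : Type) (r : seq I) (F : I -> T -> R[i]) :
  (forall i, Cintegrable (F i)) -> Cintegrable (fun x => \sum_(i <- r) F i x).
Proof.
move=> h; elim: r => [|i r IH].
  by under eq_fun do rewrite big_nil; exact: Cintegrable0.
by under eq_fun do rewrite big_cons; exact: CintegrableD.
Qed.

Lemma CintD f g : Cintegrable f -> Cintegrable g ->
  Cint (fun x => f x + g x) = Cint f + Cint g.
Proof.
move=> [f1 f2] [g1 g2]; apply: complexP; rewrite ?cReD ?cImD /=.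
  by rewrite -RintegralD //; apply: eq_Rintegral => x _; rewrite cReD.
by rewrite -RintegralD //; apply: eq_Rintegral => x _; rewrite cImD.
Qed.

Lemma CintZ c f : Cintegrable f -> Cint (fun x => c * f x) = c * Cint f.
Proof.
move=> [f1 f2]; apply: complexP; rewrite ?cReM ?cImM /=.
  rewrite -!RintegralZl // -RintegralB //; try exact: RintegrableZl.
  by apply: eq_Rintegral => x _; rewrite cReM.
rewrite -!RintegralZl // -RintegralD //; try exact: RintegrableZl.
by apply: eq_Rintegral => x _; rewrite cImM.
Qed.

Lemma Cint0 : Cint (fun=> 0) = 0.
Proof.
have h : \int[mu]_(x in [set: T]) (0 : R) = 0 by rewrite /Rintegral integral0.
by apply: complexP => /=.
Qed.

Lemma eq_Cint f g : f =1 g -> Cint f = Cint g.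
Proof. by move=> /funext ->. Qed.

Lemma Cint_sum (I : Type) (r : seq I) (F : I -> T -> R[i]) :
  (forall i, Cintegrable (F i)) -> Cint (fun x => \sum_(i <- r) F i x) = \sum_(i <- r) Cint (F i).
Proof.
move=> h; elim: r => [|i r IH].
  by rewrite big_nil -[RHS]Cint0; apply: eq_Cint => x; rewrite big_nil.
rewrite big_cons -IH -CintD //; last exact: Cintegrable_sum.
by apply: eq_Cint => x; rewrite big_cons.
Qed.
End Cint.

Section Gauss1D.
Context {R : realType}.
Local Notation mu := (@lebesgue_measure R).
Local Notation Re := (@complex.Re R).
Local Notation Im := (@complex.Im R).

(** The Gaussian is a multiple of the density of a centered normal law of variance
    1 / (2 a). *)
Lemma gaussian_integral (a : R) : 0 < a ->
  mu.-integrable setT (fun x => (expR (- (a * x ^+ 2)))%:E) /\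
  \int[mu]_x expR (- (a * x ^+ 2)) = Num.sqrt (pi / a).
Proof.
move=> a0; pose s := (Num.sqrt (2 * a))^-1.
have s0 : s != 0 by rewrite invr_neq0 // gt_eqF // sqrtr_gt0 mulr_gt0.
have s2 : s ^+ 2 = (2 * a)^-1 by rewrite /s exprVn sqr_sqrtr // mulr_ge0 // ltW.
have E x : normal_pdf 0 s x = (Num.sqrt (pi / a))^-1 * expR (- (a * x ^+ 2)).
  rewrite normal_pdfE //; congr (_^-1 * expR _).
    by congr Num.sqrt; rewrite s2 -mulr_natr; field; rewrite gt_eqF.
  rewrite subr0 s2 -mulr_natr; field; rewrite gt_eqF //.
have q0 : Num.sqrt (pi / a) != 0 by rewrite gt_eqF // sqrtr_gt0 divr_gt0 // pi_gt0.
have E' x : expR (- (a * x ^+ 2)) = Num.sqrt (pi / a) * normal_pdf 0 s x.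
  by rewrite E mulVKf.
have ip := integrable_normal_pdf 0 s.
split.
  by under eq_fun do rewrite E'; exact: RintegrableZl.
under eq_Rintegral do rewrite E'.
by rewrite RintegralZl // /Rintegral integral_normal_pdf /= mulr1.
Qed.

(** From 1 + b x^2 <= exp (b x^2) follows |x| <= (1 / b + 1) exp (b x^2).  For
    b = a / (k + 1) the k-th power of the right-hand side is absorbed by the Gaussian. *)
Lemma poly_gauss_bound (a : R) (k : nat) : 0 < a ->
  exists C, forall x, `|x| ^+ k * expR (- (a * x ^+ 2)) <= C.
Proof.
move=> a0.
pose b := a / k.+1%:R; have b0 : 0 < b by rewrite divr_gt0.
exists ((b^-1 + 1) ^+ k) => x.
have h : `|x| <= (b^-1 + 1) * expR (b * x ^+ 2).
  have := expR_ge1Dx (b * x ^+ 2); have : 0 < b^-1 by rewrite invr_gt0.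
  have : b * b^-1 = 1 by rewrite mulfV // gt_eqF.
  move: (b^-1) (expR _) => c e bc c0 he.
  have x2 : x ^+ 2 = `|x| ^+ 2 by rewrite real_normK // num_real.
  rewrite x2 in he; have xge0 := normr_ge0 x; move: `|x| xge0 he => y y0 he.
  have h1 : (c + 1) * (1 + b * y ^+ 2) <= (c + 1) * e by rewrite ler_pM2l //; lra.
  apply: le_trans h1.
  have -> : (c + 1) * (1 + b * y ^+ 2) = 1 + c + b * y^+2 + (b * c) * y ^+ 2 by ring.
  rewrite bc; have : 0 <= b * y ^+ 2 by rewrite mulr_ge0 ?sqr_ge0 // ltW.
  nra.
have h2 : `|x| ^+ k <= (b^-1 + 1) ^+ k * expR (a * x ^+ 2).
  apply: (@le_trans _ _ (((b^-1 + 1) * expR (b * x ^+ 2)) ^+ k)).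
    have p1 : 0 <= (b^-1 + 1) * expR (b * x ^+ 2) by apply: le_trans h.
    by apply: lerXn2r => //; rewrite nnegrE.
  rewrite exprMn ler_wpM2l // ?exprn_ge0 ?addr_ge0 ?invr_ge0 ?(ltW b0) //.
  rewrite -expRM_natl ler_expR /b mulrA ler_wpM2r ?sqr_ge0 // mulrCA.
  rewrite ler_piMr ?(ltW a0) // ler_pdivrMr ?ltr0n // mul1r ler_nat //.
rewrite expRN -ler_pdivlMr ?invr_gt0 ?expR_gt0 // invrK //.
Qed.

(** One half of the exponent bounds the power, the other half is integrable. *)
Lemma poly_gauss_integrable (a : R) (k : nat) : 0 < a ->
  mu.-integrable setT (fun x => (`|x| ^+ k * expR (- (a * x ^+ 2)))%:E).
Proof.
move=> a0; have a20 : 0 < a / 2 by rewrite divr_gt0.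
have [C hC] := poly_gauss_bound k a20.
have [ig _] := gaussian_integral a20.
apply: (le_integrable _ _ _ (RintegrableZl C ig)) => //.
  apply/measurable_EFinP; apply: measurable_funM.
    by apply: measurable_funX; exact: normr_measurable.
  apply: measurableT_comp => //; apply: measurableT_comp => //.
  by apply: measurable_funM => //; apply: measurable_funX.
move=> x _; rewrite /= lee_fin.
rewrite ger0_norm; last by rewrite mulr_ge0 ?exprn_ge0 ?expR_ge0.
apply: le_trans (ler_norm _).
have -> : - (a * x ^+ 2) = - (a / 2 * x ^+ 2) + - (a / 2 * x ^+ 2) by field.
by rewrite expRD mulrA ler_wpM2r ?expR_ge0.
Qed.
End Gauss1D.

(** * Differentiation under the integral sign and integration by parts *)

Section Param.
Context {R : realType}.
Local Notation mu := (@lebesgue_measure R).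

Lemma measurable_gauss (a : R) : measurable_fun setT (fun x : R => expR (- (a * x ^+ 2))).
Proof.
apply: measurableT_comp => //; apply: measurableT_comp => //.
by apply: measurable_funM => //; apply: measurable_funX.
Qed.

Lemma measurable_cos_comp {d} {T : measurableType d} (f : T -> R) :
  measurable_fun setT f -> measurable_fun setT (fun x => cos (f x)).
Proof.
by move=> mf; apply: measurableT_comp => //; apply: continuous_measurable_fun; exact: continuous_cos.
Qed.

Lemma measurable_sin_comp {d} {T : measurableType d} (f : T -> R) :
  measurable_fun setT f -> measurable_fun setT (fun x => sin (f x)).
Proof.
by move=> mf; apply: measurableT_comp => //; apply: continuous_measurable_fun; exact: continuous_sin.
Qed.

Lemma gauss_trig_integrable (a : R) (k : nat) (g h : R -> R) : 0 < a -> measurable_fun setT g -> measurable_fun setT h ->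
  (forall x, `|g x| <= `|x| ^+ k) -> (forall x, `|h x| <= 1) ->
  mu.-integrable setT (fun x => (g x * (expR (- (a * x ^+ 2)) * h x))%:E).
Proof.
move=> a0 mg mh gk h1; apply: (le_integrable _ _ _ (poly_gauss_integrable k a0)) => //.
  apply/measurable_EFinP; apply: measurable_funM => //; apply: measurable_funM => //.
  exact: measurable_gauss.
move=> x _; rewrite /= lee_fin !normrM.
rewrite (ger0_norm (expR_ge0 _)) (ger0_norm (exprn_ge0 _ (normr_ge0 x))).
by rewrite ler_pM ?mulr_ge0 ?expR_ge0 // ler_piMr ?expR_ge0.
Qed.
Variables (a : R) (k : nat) (m phi : R -> R).
Hypothesis a0 : 0 < a.
Hypothesis mm : measurable_fun setT m.
Hypothesis mphi : measurable_fun setT phi.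
Hypothesis mk : forall x, `|m x| <= `|x| ^+ k.

(** The derivative of the integrand in t is bounded by |x|^k exp (- a x^2), an integrable
    function that does not depend on t. *)
Lemma is_derive_gauss_cos (t : R) :
  is_derive t 1 (fun t => \int[mu]_x (expR (- (a * x ^+ 2)) * cos (t * m x + phi x)))
    (\int[mu]_x (- m x * (expR (- (a * x ^+ 2)) * sin (t * m x + phi x)))).
Proof.
pose f (t x : R) : R := expR (- (a * x ^+ 2)) * cos (t * m x + phi x).
have dfx (s x : R) : is_derive s 1 (f ^~ x) (- m x * (expR (- (a * x ^+ 2)) * sin (s * m x + phi x))).
  have h : is_derive s 1 (fun t => t * m x + phi x) (m x).
    have h0 : is_derive s 1 (fun t => t * m x) (m x).
      rewrite (_ : (fun t => _) = m x \*: (@id R)); last first.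
        by apply/funext => y; rewrite /= /GRing.scale /= mulrC.
      by apply: is_derive_eq; rewrite /GRing.scale /= mulr1.
    by have := is_deriveD h0 (is_derive_cst (phi x) s 1); rewrite addr0.
  have hc := @is_derive1_comp R cos (fun t => t * m x + phi x) s _ _ (is_derive_cos _) h.
  have h2 : is_derive s 1 (f ^~ x) _ := is_deriveZ (expR (- (a * x ^+ 2))) hc.
  apply: (is_derive_eq h2).
  by rewrite /GRing.scale /=; ring.
have pE s x : partial1of2 f s x = - m x * (expR (- (a * x ^+ 2)) * sin (s * m x + phi x)).
  by rewrite partial1of2E; apply: derive_val.
pose I : set R := [set` `](t - 1), (t + 1)[].
have Ia : I t by rewrite /I /= in_itv /=; lra.
have intf x : I x -> mu.-integrable setT (EFin \o f x).
  move=> _; have := @gauss_trig_integrable a 0 (fun=> 1) (fun y => cos (x * m y + phi y)) a0.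
  rewrite (_ : (fun x0 => (1 * _)%:E) = EFin \o f x); last first.
    by apply/funext => y /=; rewrite mul1r.
  apply => //.
  - apply: measurable_cos_comp; apply: measurable_funD => //; exact: measurable_funM.
  - by move=> y; rewrite normr1 expr0.
  - by move=> y; exact: cos_max.
have der x y : I x -> setT y -> derivable (f ^~ y) x 1.
  by move=> _ _; have [] := dfx x y.
pose G (y : R) := `|y| ^+ k * expR (- (a * y ^+ 2)).
have G0 y : 0 <= G y by rewrite mulr_ge0 ?exprn_ge0 ?expR_ge0.
have intG : mu.-integrable setT (EFin \o G) by exact: poly_gauss_integrable.
have Gub x y : I x -> setT y -> `|partial1of2 f x y| <= G y.
  move=> _ _; rewrite pE !normrM normrN /G (ger0_norm (expR_ge0 _)).
  by rewrite ler_pM ?mulr_ge0 ?expR_ge0 // ler_piMr ?expR_ge0 // sin_max.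
apply: DeriveDef.
  exact: (@derivable_under_integral R _ _ mu f setT measurableT t (t - 1) (t + 1) Ia intf der G G0 intG Gub).
rewrite -derive1E.
rewrite (@differentiation_under_integral R _ _ mu f setT measurableT t (t - 1) (t + 1) Ia intf der G G0 intG Gub).
by apply: eq_Rintegral => x _; exact: pE.
Qed.
End Param.

Section LineFTC.
Context {R : realType}.
Local Notation mu := (@lebesgue_measure R).

(** The fundamental theorem of calculus on [-n, n], followed by dominated convergence. *)
Lemma Rintegral_derive_line (F f : R -> R) :
  (forall x : R, is_derive x 1 F (f x)) -> continuous f ->
  mu.-integrable setT (fun x => (f x)%:E) ->
  F n%:R @[n --> \oo] --> 0 -> F (- n%:R) @[n --> \oo] --> 0 ->
  \int[mu]_x f x = 0.
Proof.
move=> dF cf intf Fp Fm.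
have step (n : nat) : \int[mu]_(x in `[- n.+1%:R, n.+1%:R]) f x = F n.+1%:R - F (- n.+1%:R).
  have lt : (- n.+1%:R : R) < n.+1%:R by rewrite -subr_gt0 opprK addr_gt0.
  have cF x : {for x, continuous F}.
    by apply: differentiable_continuous; apply/derivable1_diffP; case: (dF x).
  rewrite /Rintegral (@continuous_FTC2 R f F _ _ lt) //=.
  - exact: continuous_subspaceT.
  - split.
    + by move=> x _; case: (dF x).
    + by apply: cvg_at_right_filter; exact: cF.
    + by apply: cvg_at_left_filter; exact: cF.
  - by move=> x _; rewrite derive1E; apply: derive_val.
have lim1 : (fun n => \int[mu]_(x in `[- n.+1%:R, n.+1%:R]) f x) @ \oo --> (0 : R).
  under eq_fun do rewrite step.
  have Fp' : F n.+1%:R @[n --> \oo] --> 0 by rewrite (cvg_shiftS (fun n => F n%:R)).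
  have Fm' : F (- n.+1%:R) @[n --> \oo] --> 0 by rewrite (cvg_shiftS (fun n => F (- n%:R))).
  have h := cvgB Fp' Fm'; rewrite subr0 in h. exact: h.
have lim2 : (fun n => \int[mu]_(x in `[- n.+1%:R, n.+1%:R]) f x) @ \oo --> \int[mu]_x f x.
  apply: fine_cvg; rewrite /Rintegral fineK; last exact: integrable_fin_num.
  under eq_fun do rewrite integral_mkcond.
  apply: (@dominated_cvg _ _ _ mu setT measurableT _ _ (fun x => `|f x|%:E)) => //.
  - move=> n; apply: (iffLR (measurable_restrictT _ (measurable_itv _))); apply: measurable_funTS.
    by apply/measurable_EFinP; exact: continuous_measurable_fun.
  - move=> x _; apply: cvg_near_cst; near=> n.
    rewrite patchE mem_set //= in_itv /= -ler_norml.
    have : `|x| <= n%:R by near: n; exact: nbhs_infty_ger.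
    by move=> h; apply: (le_trans h); rewrite ler_nat.
  - exact: integrable_norm.
  - by move=> n x _; rewrite patchE; case: ifP => _; rewrite ?abse0 lee_fin.
exact: esym (cvg_unique _ lim1 lim2).
Unshelve. all: by end_near. Qed.
End LineFTC.

Section GaussPhase.
Context {R : realType}.
Local Notation mu := (@lebesgue_measure R).
Local Notation Re := (@complex.Re R).
Local Notation Im := (@complex.Im R).

(** The phase is kept apart from the real width since the parameters of the differential
    equations below act on the phase only. *)
Definition gauss_phase (a th x : R) : R[i] := cexp ((- (a * x ^+ 2)) +i* th)%C.

Lemma gauss_phase_integrable (a : R) (k : nat) (m phi : R -> R) : 0 < a ->
  measurable_fun setT m -> measurable_fun setT phi -> (forall x, `|m x| <= `|x| ^+ k) ->
  Cintegrable mu (fun x => (m x)%:C%C * gauss_phase a (phi x) x).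
Proof.
move=> a0 mm mphi mk; split.
  under eq_fun do rewrite cReM /= mul0r subr0.
  apply: (@gauss_trig_integrable R a k) => //; first exact: measurable_cos_comp.
  by move=> x; exact: cos_max.
under eq_fun do rewrite cImM /= mul0r addr0.
apply: (@gauss_trig_integrable R a k) => //; first exact: measurable_sin_comp.
by move=> x; exact: sin_max.
Qed.

Lemma cosBpihalf (y : R) : cos (y - pi / 2) = sin y.
Proof. by rewrite cosB cos_pihalf sin_pihalf mulr0 mulr1 add0r. Qed.
Lemma sinBpihalf (y : R) : sin (y - pi / 2) = - cos y.
Proof. by rewrite sinB cos_pihalf sin_pihalf mulr0 mulr1 add0r. Qed.

Variables (a : R) (k : nat) (m phi : R -> R).
Hypothesis a0 : 0 < a.
Hypothesis mm : measurable_fun setT m.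
Hypothesis mphi : measurable_fun setT phi.
Hypothesis mk : forall x, `|m x| <= `|x| ^+ k.

(** The imaginary part reduces to the real part by shifting the phase by pi / 2. *)
Lemma Cderive_gauss_phase_int (t : R) : Cderive (fun t => Cint mu (fun x => gauss_phase a (t * m x + phi x) x)) t
  ((0 +i* 1)%C * Cint mu (fun x => (m x)%:C%C * gauss_phase a (t * m x + phi x) x)).
Proof.
have mtp : measurable_fun setT (fun x => t * m x + phi x).
  by apply: measurable_funD => //; exact: measurable_funM.
have [i1 i2] := gauss_phase_integrable a0 mm mtp mk.
split.
  have h : is_derive t 1 (Re \o (fun t => Cint mu (fun x => gauss_phase a (t * m x + phi x) x))) _ :=
    is_derive_gauss_cos a0 mm mphi mk t.
  apply: (is_derive_eq h).
  rewrite cReM /= mul0r sub0r mul1r -[RHS]mulN1r -RintegralZl //.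
  by apply: eq_Rintegral => x _; rewrite mul0r addr0 mulN1r mulNr.
have mphi' : measurable_fun setT (fun x => phi x - pi / 2) by exact: measurable_funB.
have := is_derive_gauss_cos a0 mm mphi' mk t.
rewrite (_ : (fun t => \int[mu]_x _) =
    (Im \o (fun t => Cint mu (fun x => gauss_phase a (t * m x + phi x) x)))); last first.
  by apply/funext => s; apply: eq_Rintegral => x _; rewrite addrA cosBpihalf.
move=> h; apply: (is_derive_eq h).
rewrite cImM /= mul0r add0r mul1r; apply: eq_Rintegral => x _.
by rewrite addrA sinBpihalf mul0r subr0 mulrN mulrNN.
Qed.
End GaussPhase.

Section GaussFourier1D.
Context {R : realType}.
Local Notation mu := (@lebesgue_measure R).
Local Notation Re := (@complex.Re R).
Local Notation Im := (@complex.Im R).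

(** This is exp (- z x^2 + i b x). *)
Definition chirp (z : R[i]) (b x : R) : R[i] :=
  gauss_phase (Re z) (b * x - Im z * x ^+ 2) x.

Lemma normc_chirp z b x : Normc.normc (chirp z b x) = expR (- (Re z * x ^+ 2)).
Proof. by rewrite /chirp /gauss_phase normc_cexp. Qed.

Lemma chirp_integrable z b k : 0 < Re z ->
  Cintegrable mu (fun x => (x ^+ k)%:C%C * chirp z b x).
Proof.
move=> z0; apply: (gauss_phase_integrable z0 (k := k)).
- exact: measurable_funX.
- by apply: measurable_funB; apply: measurable_funM => //; exact: measurable_funX.
- by move=> x; rewrite normrX.
Qed.

Lemma is_derive_expn (k : nat) (x : R) :
  is_derive x 1 (fun x => x ^+ k) (k%:R * x ^+ k.-1).
Proof.
have := @is_deriveX R R id k x 1 1 (is_derive_id _ _).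
by rewrite exprfctE /GRing.scale /= mulr1.
Qed.

Lemma Cderive_chirp z b k (x : R) : Cderive (fun x => (x ^+ k)%:C%C * chirp z b x) x
  ((k%:R * x ^+ k.-1)%:C%C * chirp z b x +
   (x ^+ k)%:C%C * ((- (2 * x)%:C%C * z + (0 +i* b)%C) * chirp z b x)).
Proof.
apply: CderiveM.
  by apply: Cderive_real; exact: is_derive_expn.
apply: Cderive_cexp; split => /=.
  have h : is_derive x 1 (fun x => - (Re z * x ^+ 2)) _ :=
    is_deriveN (is_deriveZ (Re z) (is_derive_expn 2 x)).
  apply: (is_derive_eq h); rewrite /GRing.scale cReD cReM cReN cImN /=; ring.
have h : is_derive x 1 (fun x => b * x - Im z * x ^+ 2) _ :=
  is_deriveB (is_deriveZ b (is_derive_id x 1)) (is_deriveZ (Im z) (is_derive_expn 2 x)).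
apply: (is_derive_eq h); rewrite /GRing.scale cImD cImM cReN cImN /=; ring.
Qed.
End GaussFourier1D.

(** * The Fourier transform of complex Gaussians on the line *)

Section GaussFourier1D.
Context {R : realType}.
Local Notation mu := (@lebesgue_measure R).
Local Notation Re := (@complex.Re R).
Local Notation Im := (@complex.Im R).
Local Notation ii := (0 +i* 1 : R[i])%C.

Definition Ccont (f : R -> R[i]) := continuous (Re \o f) /\ continuous (Im \o f).

Lemma CcontD f g : Ccont f -> Ccont g -> Ccont (fun x => f x + g x).
Proof.
move=> [f1 f2] [g1 g2]; split.
  rewrite (_ : _ \o _ = fun x => Re (f x) + Re (g x)); last by apply/funext => x /=; rewrite cReD.
  by move=> x; apply: (@continuousD R R _ (Re \o f) (Re \o g)); [exact: f1|exact: g1].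
rewrite (_ : _ \o _ = fun x => Im (f x) + Im (g x)); last by apply/funext => x /=; rewrite cImD.
by move=> x; apply: (@continuousD R R _ (Im \o f) (Im \o g)); [exact: f2|exact: g2].
Qed.

Lemma CcontZ c f : Ccont f -> Ccont (fun x => c * f x).
Proof.
move=> [f1 f2].
have h (k : R) (g : R -> R) : continuous g -> continuous (fun x => k * g x).
  by move=> cg x; apply: (@continuousM R R (cst k) g); [exact: cst_continuous|exact: cg].
split.
  rewrite (_ : _ \o _ = (fun x => Re c * Re (f x)) - (fun x => Im c * Im (f x))); last first.
    by apply/funext => x /=; rewrite cReM.
  by move=> x; apply: continuousB; apply: h.
rewrite (_ : _ \o _ = (fun x => Re c * Im (f x)) + (fun x => Im c * Re (f x))); last first.
  by apply/funext => x /=; rewrite cImM.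
by move=> x; apply: continuousD; apply: h.
Qed.

Lemma Ccont_chirp z b k : Ccont (fun x : R => (x ^+ k)%:C%C * chirp z b x).
Proof.
split=> x; have [h1 h2] := Cderive_chirp z b k x.
  by apply: differentiable_continuous; apply/derivable1_diffP; case: h1.
by apply: differentiable_continuous; apply/derivable1_diffP; case: h2.
Qed.

Lemma chirp_decay z b k : 0 < Re z ->
  exists C, forall x : R, Normc.normc ((x ^+ k)%:C%C * chirp z b x) <= C / (1 + `|x|).
Proof.
move=> z0; have [C1 h1] := poly_gauss_bound k z0.
have [C2 h2] := poly_gauss_bound k.+1 z0.
exists (C1 + C2) => x; rewrite normcM normc_chirp normcRI /= expr0n /= addr0 sqrtr_sqr.
rewrite normrX ler_pdivlMr; last by rewrite ltr_pwDl.
rewrite mulrDr mulr1 lerD // mulrAC -exprSr; exact: h2.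
Qed.

Lemma inv_nat_cvg0 (C : R) (s : R) (g : R -> R) : `|s| = 1 ->
  (forall x, `|g x| <= C / (1 + `|x|)) -> g (s * n%:R) @[n --> \oo] --> 0.
Proof.
move=> s1 gC; apply: norm_cvg0.
apply: (@squeeze_cvgr _ _ _ _ (cst 0) (fun n => C * harmonic n)).
- apply: nearW => n; rewrite normr_ge0 /=; apply: le_trans (gC _) _.
  by rewrite normrM s1 mul1r normr_nat /harmonic /= -natr1 addrC.
- exact: cvg_cst.
- by rewrite -[X in _ --> X](mulr0 C); apply: cvgMr; exact: cvg_harmonic.
Qed.

Definition chirp_moment z b k := Cint mu (fun x : R => (x ^+ k)%:C%C * chirp z b x).

(** The derivative of x^k exp (- z x^2 + i b x) has integral 0 over the line. *)
Lemma chirp_ibp z b k : 0 < Re z ->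
  k%:R * chirp_moment z b k.-1 - 2 * z * chirp_moment z b k.+1 + ii * b%:C%C * chirp_moment z b k = 0.
Proof.
move=> z0.
pose D (x : R) := k%:R * ((x ^+ k.-1)%:C%C * chirp z b x)
  + ((- (2 * z)) * ((x ^+ k.+1)%:C%C * chirp z b x)
  + (ii * b%:C%C) * ((x ^+ k)%:C%C * chirp z b x)).
have iD : Cintegrable mu D.
  by apply: CintegrableD; [|apply: CintegrableD]; apply: CintegrableZ; exact: chirp_integrable.
have dF x : Cderive (fun x => (x ^+ k)%:C%C * chirp z b x) x (D x).
  apply: Cderive_eq; first exact: Cderive_chirp.
  rewrite /D; set c := chirp _ _ _.
  rewrite exprS !rmorphM /= !rmorph_nat.
  have -> : (0 +i* b)%C = ii * b%:C%C by apply: complexP; rewrite ?cReM ?cImM /=; ring.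
  ring.
have cD : Ccont D.
  by apply: CcontD; [|apply: CcontD]; apply: CcontZ; exact: Ccont_chirp.
have [cR cI] := cD.
have [C hC] := chirp_decay b k z0.
have gR x : `|Re ((x ^+ k)%:C%C * chirp z b x)| <= C / (1 + `|x|) := le_trans (normc_Re _) (hC x).
have gI x : `|Im ((x ^+ k)%:C%C * chirp z b x)| <= C / (1 + `|x|) := le_trans (normc_Im _) (hC x).
have n1 : `|1 : R| = 1 by rewrite normr1.
have nN1 : `|-1 : R| = 1 by rewrite normrN1.
have E : Cint mu D = 0.
  have [iR iI] := iD.
  apply: complexP => /=.
    apply: (@Rintegral_derive_line R (Re \o (fun x => (x ^+ k)%:C%C * chirp z b x)) (Re \o D)) => //.
    - by move=> x; case: (dF x).
    - by have := inv_nat_cvg0 n1 gR; under eq_fun do rewrite mul1r.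
    - by have := inv_nat_cvg0 nN1 gR; under eq_fun do rewrite mulN1r.
  apply: (@Rintegral_derive_line R (Im \o (fun x => (x ^+ k)%:C%C * chirp z b x)) (Im \o D)) => //.
  - by move=> x; case: (dF x).
  - by have := inv_nat_cvg0 n1 gI; under eq_fun do rewrite mul1r.
  - by have := inv_nat_cvg0 nN1 gI; under eq_fun do rewrite mulN1r.
have iC j := chirp_integrable b j z0.
move: E; rewrite /D CintD; last 2 first.
- exact: CintegrableZ.
- by apply: CintegrableD; apply: CintegrableZ.
rewrite CintD; try exact: CintegrableZ.
by rewrite !CintZ // -!/(chirp_moment _ _ _) mulNr addrA.
Qed.

Lemma chirp_moment1 z b : 0 < Re z -> chirp_moment z b 1 = ii * b%:C%C / (2 * z) * chirp_moment z b 0.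
Proof.
move=> z0; have zn : z != 0 by apply: contraTneq z0 => ->; rewrite /= ltxx.
have := chirp_ibp b 0 z0; rewrite mul0r sub0r => /eqP.
rewrite addrC subr_eq0 => /eqP h.
have -> : ii * b%:C%C / (2 * z) * chirp_moment z b 0 = ii * b%:C%C * chirp_moment z b 0 / (2 * z) by rewrite mulrAC.
rewrite h; field; exact: zn.
Qed.

Lemma chirp_moment2 z : 0 < Re z -> chirp_moment z 0 2 = chirp_moment z 0 0 / (2 * z).
Proof.
move=> z0; have zn : z != 0 by apply: contraTneq z0 => ->; rewrite /= ltxx.
have := chirp_ibp 0 1 z0; rewrite rmorph0 mulr0 mul0r addr0 mul1r => /eqP.
rewrite subr_eq0 /= => /eqP ->; field; exact: zn.
Qed.

(** Integration by parts shows that the integral I(b) satisfies I' = - b / (2 z) I, so that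
    I(b) exp (b^2 / (4 z)) is constant. *)
Lemma chirp_moment0_freq z b : 0 < Re z -> chirp_moment z b 0 = chirp_moment z 0 0 * cexp (- (b ^+ 2)%:C%C / (4 * z)).
Proof.
move=> z0; have zn : z != 0 by apply: contraTneq z0 => ->; rewrite /= ltxx.
pose g b := chirp_moment z b 0 * cexp ((b ^+ 2)%:C%C * (4 * z)^-1).
suff h : g b = g 0.
  have e : cexp ((b ^+ 2)%:C%C * (4 * z)^-1) * cexp (- (b ^+ 2)%:C%C / (4 * z)) = 1.
    by rewrite mulrC mulNr cexpN.
  rewrite -[LHS]mulr1 -[X in _ * X = _]e mulrA; congr (_ * _).
  by move: h; rewrite /g expr0n /= mul0r cexp0 mulr1 => <-.
apply: (@Cderive0_cst R g) => t.
have h1 : Cderive (fun b => chirp_moment z b 0) t (ii * chirp_moment z t 1).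
  have m1 : measurable_fun setT (@id R) by exact: measurable_id.
  have m2 : measurable_fun setT (fun x : R => - (Im z * x ^+ 2)).
    by apply: measurableT_comp => //; apply: measurable_funM => //; exact: measurable_funX.
  have mk (x : R) : `|id x| <= `|x| ^+ 1 by rewrite expr1.
  have := Cderive_gauss_phase_int z0 m1 m2 mk t.
  rewrite (_ : (fun t => Cint _ _) = (fun b => chirp_moment z b 0)); last first.
    by apply/funext => s; apply: eq_Cint => x; rewrite expr0 mul1r.
  move=> h; apply: (Cderive_eq h); congr (_ * _).
have h2 : Cderive (fun b : R => cexp ((b ^+ 2)%:C%C * (4 * z)^-1)) t
   (((2 * t)%:C%C * (4 * z)^-1) * cexp ((t ^+ 2)%:C%C * (4 * z)^-1)).
  apply: Cderive_cexp.
  have h := CderiveM (Cderive_real (is_derive_expn 2 t)) (Cderive_cst (4 * z)^-1 t).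
  by apply: (Cderive_eq h); rewrite mulr0 addr0 expr1.
apply: (Cderive_eq (CderiveM h1 h2)); rewrite chirp_moment1 // [(2 * t)%:C%C]rmorphM rmorph_nat.
have i2 : ii * ii = -1 by apply: complexP; rewrite ?cReM ?cImM /=; ring.
set E := cexp _; set j := chirp_moment _ _ _; set u := (t%:C)%C.
transitivity ((ii * ii + 1) * (u * j * E / (2 * z))); first by field.
by rewrite i2 addNr mul0r.
Qed.

(** Along z = a + i t the integral satisfies dI/dt = - i I / (2 z), so I^2 z is constant in
    t, and at t = 0 it is given by the real Gaussian integral.  Squaring avoids the choice
    of a square root of z. *)
Lemma chirp_moment0_sqr z : 0 < Re z -> chirp_moment z 0 0 ^+ 2 * z = (pi : R)%:C%C.
Proof.
move=> z0; set a := Re z.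
pose zb (t : R) : R[i] := (a +i* t)%C.
have zE : z = zb (Im z) by rewrite /zb /a; case: (z).
pose g t := chirp_moment (zb t) 0 0 ^+ 2 * zb t.
have -> : chirp_moment z 0 0 ^+ 2 * z = g (Im z) by rewrite /g -zE.
have -> : g (Im z) = g 0.
  apply: (@Cderive0_cst R g) => t.
  have zn : zb t != 0 by apply/eqP => /(congr1 Re) /= e; move: z0; rewrite -/a e ltxx.
  have h1 : Cderive (fun t => chirp_moment (zb t) 0 0) t (- ii * chirp_moment (zb t) 0 2).
    have m1 : measurable_fun setT (fun x : R => - (x ^+ 2)).
      by apply: measurableT_comp => //; exact: measurable_funX.
    have m2 : measurable_fun setT (fun x : R => 0 : R) by exact: measurable_cst.
    have mk (x : R) : `|- (x ^+ 2)| <= `|x| ^+ 2 by rewrite normrN normrX.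
    have := Cderive_gauss_phase_int z0 m1 m2 mk t.
    rewrite (_ : (fun t => Cint _ _) = (fun t => chirp_moment (zb t) 0 0)); last first.
      apply/funext => s; apply: eq_Cint => x; rewrite expr0 mul1r /chirp /=.
      by rewrite mul0r sub0r addr0 mulrN.
    move=> h; apply: (Cderive_eq h); rewrite mulNr -mulrN; congr (_ * _).
    rewrite -mulN1r -CintZ; last exact: chirp_integrable.
    apply: eq_Cint => x; rewrite mulrA rmorphN mulN1r; congr (_ * _).
    by rewrite /chirp /= mul0r sub0r addr0 mulrN.
  have h2 : Cderive zb t ii.
    by split; [exact: is_derive_cst|exact: is_derive_id].
  have h3 := CderiveM (CderiveM h1 h1) h2.
  rewrite (_ : g = (fun t => chirp_moment (zb t) 0 0 * chirp_moment (zb t) 0 0 * zb t)); last first.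
    by apply/funext => s; rewrite /g expr2.
  apply: (Cderive_eq h3); rewrite chirp_moment2 //; set j := chirp_moment _ _ _; field; exact: zn.
have [_ gi] := gaussian_integral z0.
have c0 x : chirp (zb 0) 0 x = (expR (- (a * x ^+ 2)))%:C%C.
  rewrite /chirp /gauss_phase /cexp /= !mul0r subr0 cos0 sin0 mulr0 mulr1 //.
have E : chirp_moment (zb 0) 0 0 = (Num.sqrt (pi / a))%:C%C.
  rewrite -/a in gi; rewrite -gi.
  transitivity (Cint mu (fun x => (expR (- (a * x ^+ 2)))%:C%C)).
    by apply: eq_Cint => x; rewrite c0 expr0 mul1r.
  by apply: complexP => //=; rewrite /Rintegral integral0.
rewrite /g E -rmorphXn /= sqr_sqrtr ?divr_ge0 ?pi_ge0 ?(ltW z0) //.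
have -> : zb 0 = (a%:C)%C by [].
by rewrite -rmorphM /= divfK // gt_eqF.
Qed.
End GaussFourier1D.

(** * The Fourier transform of complex Gaussians on the plane *)

Section ProductIntegral.
Context {d1 d2 : measure_display} {T1 : measurableType d1} {T2 : measurableType d2}.
Context {R : realType}.
Variable m1 : {sigma_finite_measure set T1 -> \bar R}.
Variable m2 : {sigma_finite_measure set T2 -> \bar R}.

Lemma Rintegral_prod (u : T1 -> R) (v : T2 -> R) :
  m1.-integrable setT (fun x => (u x)%:E) -> m2.-integrable setT (fun x => (v x)%:E) ->
  (m1 \x m2)%E.-integrable setT (fun x => (u x.1 * v x.2)%:E) /\
  \int[(m1 \x m2)%E]_x (u x.1 * v x.2) = (\int[m1]_x u x) * (\int[m2]_x v x).
Proof.
move=> iu iv.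
have mu_ : measurable_fun setT u by apply/measurable_EFinP; exact: (measurable_int m1).
have mv : measurable_fun setT v by apply/measurable_EFinP; exact: (measurable_int m2).
have mf : measurable_fun [set: T1 * T2] (fun x : T1 * T2 => (u x.1 * v x.2)%:E).
  apply/measurable_EFinP; apply: measurable_funM.
    by apply: (measurableT_comp mu_); exact: measurable_fst.
  by apply: (measurableT_comp mv); exact: measurable_snd.
have ii : (m1 \x m2)%E.-integrable setT (fun x => (u x.1 * v x.2)%:E).
  apply/integrable12ltyP => //.
  rewrite (eq_integral (fun x => (\int[m2]_y (`|v y|)%:E) * (`|u x|)%:E)%E); last first.
    move=> x _; under eq_integral => y _ do rewrite /= normrM EFinM.
    rewrite ge0_integralZl // 1?muleC //.
    by apply/measurable_EFinP; exact: measurableT_comp.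
  have fv : (\int[m2]_y (`|v y|)%:E < +oo)%E by have /integrableP[] := iv.
  have fu : (\int[m1]_y (`|u y|)%:E < +oo)%E by have /integrableP[] := iu.
  rewrite /= ge0_integralZl //.
  - by apply: lte_mul_pinfty => //; [exact: integral_ge0|rewrite ge0_fin_numE ?integral_ge0].
  - by apply/measurable_EFinP; exact: measurableT_comp.
  - by apply: integral_ge0.
split => //; rewrite /Rintegral -integral12_prod_meas1 //=.
rewrite (eq_integral (fun x => (\int[m2]_y (v y)%:E) * (u x)%:E)%E); last first.
  by move=> x _; rewrite /fubini_F; under eq_integral => y _ do rewrite /= EFinM; rewrite integralZl // muleC.
rewrite -(fineK (integrable_fin_num measurableT iv)).
by rewrite integralZl // fineM // ?integrable_fin_num // mulrC.
Qed.
End ProductIntegral.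

Section Plane.
Context {R : realType}.
Local Notation mu := (@lebesgue_measure R).
Local Notation mu2 := (@lebesgue_measure R \x @lebesgue_measure R)%E.
Local Notation Re := (@complex.Re R).
Local Notation Im := (@complex.Im R).

Lemma Cint_prod (f g : R -> R[i]) : Cintegrable mu f -> Cintegrable mu g ->
  Cintegrable mu2 (fun x => f x.1 * g x.2) /\
  Cint mu2 (fun x => f x.1 * g x.2) = Cint mu f * Cint mu g.
Proof.
move=> [f1 f2] [g1 g2].
have [i11 e11] := Rintegral_prod f1 g1; have [i12 e12] := Rintegral_prod f1 g2.
have [i21 e21] := Rintegral_prod f2 g1; have [i22 e22] := Rintegral_prod f2 g2.
split.
  split.
    by under eq_fun do rewrite cReM; exact: RintegrableB.
  by under eq_fun do rewrite cImM; exact: RintegrableD.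
apply: complexP; rewrite ?cReM ?cImM /=.
  by rewrite -e11 -e22 -RintegralB //; apply: eq_Rintegral => x _; rewrite cReM.
by rewrite -e12 -e21 -RintegralD //; apply: eq_Rintegral => x _; rewrite cImM.
Qed.

Definition cgauss (z : R[i]) (x : R * R) : R[i] := cexp (- z * (x.1 ^+ 2 + x.2 ^+ 2)%:C%C).

Lemma cgauss_chirp z (xi x : R * R) :
  cgauss z x * expi (- (2 * pi * dot x xi)) =
  chirp z (- (2 * pi * xi.1)) x.1 * chirp z (- (2 * pi * xi.2)) x.2.
Proof.
rewrite /cgauss expiE /chirp /gauss_phase -!cexpD; congr cexp.
apply: complexP; rewrite !(cReD, cImD, cReM, cImM, cReN, cImN) /= /dot; ring.
Qed.

(** The integral over the plane is a product of two integrals over the line; of their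
    common factor at frequency 0 only the square occurs. *)
Lemma cgauss_fourier z (xi : R * R) : 0 < Re z ->
  Cintegrable mu2 (fun x => cgauss z x * expi (- (2 * pi * dot x xi))) /\
  Cint mu2 (fun x => cgauss z x * expi (- (2 * pi * dot x xi))) =
  pi%:C%C / z * cexp (- (pi ^+ 2 * (xi.1 ^+ 2 + xi.2 ^+ 2))%:C%C / z).
Proof.
move=> z0; have zn : z != 0 by apply: contraTneq z0 => ->; rewrite /= ltxx.
have iC b : Cintegrable mu (chirp z b).
  have := chirp_integrable b 0 z0.
  by rewrite (_ : (fun x => _) = chirp z b) //; apply/funext => x; rewrite expr0 mul1r.
have JE b : Cint mu (chirp z b) = chirp_moment z b 0.
  by apply: eq_Cint => x; rewrite expr0 mul1r.
have [i e] := Cint_prod (iC (- (2 * pi * xi.1))) (iC (- (2 * pi * xi.2))).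
have E : (fun x => cgauss z x * expi (- (2 * pi * dot x xi))) =
  (fun x => chirp z (- (2 * pi * xi.1)) x.1 * chirp z (- (2 * pi * xi.2)) x.2).
  by apply/funext => x; rewrite cgauss_chirp.
rewrite E; split => //; rewrite e !JE (chirp_moment0_freq (- (2 * pi * xi.1))) // (chirp_moment0_freq (- (2 * pi * xi.2))) //.
rewrite mulrACA -expr2 -cexpD -(chirp_moment0_sqr z0) mulfK //; congr (_ * cexp _).
rewrite -mulrDl -opprD -rmorphD.
have -> : (- (2 * pi * xi.1)) ^+ 2 + (- (2 * pi * xi.2)) ^+ 2 =
  4 * (pi ^+ 2 * (xi.1 ^+ 2 + xi.2 ^+ 2)) by ring.
rewrite [in LHS]rmorphM rmorph_nat; field; exact: zn.
Qed.

Lemma cgauss_int z : 0 < Re z ->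
  Cintegrable mu2 (cgauss z) /\ Cint mu2 (cgauss z) = pi%:C%C / z.
Proof.
move=> z0; have := cgauss_fourier 0 z0.
have -> : (fun x => cgauss z x * expi (- (2 * pi * dot x 0))) = cgauss z.
  apply/funext => x; rewrite /dot /= !mulr0 addr0 mulr0 oppr0.
  by rewrite /expi cos0 sin0 mulr1.
by rewrite expr0n /= addr0 mulr0 oppr0 mul0r cexp0 mulr1.
Qed.

Lemma normc_cgauss z x : Normc.normc (cgauss z x) = expR (- (Re z * (x.1 ^+ 2 + x.2 ^+ 2))).
Proof. by rewrite /cgauss normc_cexp cReM cReN /= mulr0 subr0 mulNr. Qed.

Lemma gauss2_int (a : R) : 0 < a ->
  mu2.-integrable setT (fun x => (expR (- (a * (x.1 ^+ 2 + x.2 ^+ 2))))%:E) /\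
  \int[mu2]_x expR (- (a * (x.1 ^+ 2 + x.2 ^+ 2))) = pi / a.
Proof.
move=> a0.
have z0 : 0 < Re (a%:C)%C by [].
have [[i _] e] := cgauss_int z0.
have E x : Re (cgauss a%:C%C x) = expR (- (a * (x.1 ^+ 2 + x.2 ^+ 2))).
  by rewrite /cgauss /cexp /= oppr0 !mul0r !mulr0 subr0 addr0 cos0 mulr1 mulNr.
split; first by under eq_fun do rewrite -E.
transitivity (Re (Cint mu2 (cgauss a%:C%C))).
  by apply: eq_Rintegral => x _; rewrite E.
by rewrite e -fmorph_div.
Qed.
End Plane.

(** * Sums of complex Gaussians are Schwartz functions *)

Section Schwartz.
Context {R : realType}.
Local Notation Re := (@complex.Re R).
Local Notation Im := (@complex.Im R).

Definition gauss_mono (c z : R[i]) (i j : nat) (x : R * R) : R :=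
  x.1 ^+ i * x.2 ^+ j * Re (c * cgauss z x).

(** The span of the functions [gauss_mono] is closed under partial derivatives, and its
    members are bounded against every monomial: this yields the Schwartz condition by
    induction on the word of derivatives. *)
Inductive gauss_poly : (R * R -> R) -> Prop :=
| gauss_poly0 : gauss_poly (fun=> 0)
| gauss_polyM c z i j : 0 < Re z -> gauss_poly (gauss_mono c z i j)
| gauss_polyD f g : gauss_poly f -> gauss_poly g -> gauss_poly (fun x => f x + g x).

(** Reduces directional derivatives on the plane to calculus in one variable. *)
Lemma is_derive_line (g : R * R -> R) (x v : R * R) D :
  is_derive (0 : R) (1 : R) (fun t => g (t *: v + x)) D -> is_derive x v g D.
Proof.
have E : (fun h : R => h^-1 *: ((g \o shift x) (h *: v) - g x)) =
   (fun h : R => h^-1 *: (((fun t : R => g (t *: v + x)) \o shift 0) (h *: (1 : R)) -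
      (fun t : R => g (t *: v + x)) 0)).
  by apply/funext => h /=; rewrite addr0 scale0r add0r /GRing.scale /= mulr1.
move=> [d1 d2]; apply: DeriveDef.
  by rewrite /derivable E.
by rewrite /derive E.
Qed.

Lemma gauss_mono_derive c z i j (v x : R * R) :
  is_derive x v (gauss_mono c z i j)
   ((gauss_mono ((v.1 * i%:R)%:C%C * c) z i.-1 j x + gauss_mono ((v.2 * j%:R)%:C%C * c) z i j.-1 x) +
    (gauss_mono ((- 2 * v.1)%:C%C * z * c) z i.+1 j x + gauss_mono ((- 2 * v.2)%:C%C * z * c) z i j.+1 x)).
Proof.
apply: is_derive_line.
have hl (a b : R) : is_derive (0 : R) 1 (fun t => t * a + b) a.
  have h0 : is_derive (0 : R) 1 (fun t => t * a) a.
    rewrite (_ : (fun t => _) = a \*: (@id R)); last first.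
      by apply/funext => y; rewrite /= /GRing.scale /= mulrC.
    by apply: is_derive_eq; rewrite /GRing.scale /= mulr1.
  by have := is_deriveD h0 (is_derive_cst b (0 : R) (1 : R)); rewrite addr0.
have hX (a b : R) n : is_derive (0 : R) 1 (fun t => (t * a + b) ^+ n) (n%:R * b ^+ n.-1 * a).
  have := @is_derive1_comp R (fun x => x ^+ n) (fun t => t * a + b) 0 _ _ (is_derive_expn n _) (hl a b).
  by rewrite mul0r add0r.
have hS : is_derive (0 : R) 1 (fun t => (t * v.1 + x.1) ^+ 2 + (t * v.2 + x.2) ^+ 2)
     (2 * x.1 * v.1 + 2 * x.2 * v.2).
  exact: is_deriveD (hX _ _ 2%N) (hX _ _ 2%N).
have hC := CderiveZ c (Cderive_cexp (CderiveZ (- z) (Cderive_real hS))).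
case: hC => hR _.
have hP := is_deriveM (is_deriveM (hX v.1 x.1 i) (hX v.2 x.2 j)) hR.
rewrite !mulrfctE /= !mul0r !add0r in hP.
have h : is_derive (0 : R) 1 (fun t => gauss_mono c z i j (t *: v + x)) _ := hP.
apply: (is_derive_eq h).
rewrite /gauss_mono /GRing.scale /= -/(cgauss z x).
move: (cgauss z x) => G; rewrite !(cReM, cImM, cReN, cImN) /= !exprS; ring.
Qed.

Lemma gauss_poly_derive g (v : R * R) : gauss_poly g ->
  exists2 g', gauss_poly g' & forall x, is_derive x v g (g' x).
Proof.
elim=> [|c z i j z0|f1 f2 _ [g1 h1 d1] _ [g2 h2 d2]].
- by exists (fun=> 0); [exact: gauss_poly0|move=> x; exact: is_derive_cst].
- eexists; last by move=> x; exact: gauss_mono_derive.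
  by do !apply: gauss_polyD; exact: gauss_polyM.
- exists (fun x => g1 x + g2 x); first exact: gauss_polyD.
  by move=> x; exact: (is_deriveD (d1 x) (d2 x)).
Qed.

Lemma gauss_mono_bounded c z i j : 0 < Re z -> forall a b, exists C : R, forall x : R * R,
  `|x.1 ^+ a * x.2 ^+ b * gauss_mono c z i j x| <= C.
Proof.
move=> z0 a b.
have [C1 h1] := poly_gauss_bound (a + i) z0.
have [C2 h2] := poly_gauss_bound (b + j) z0.
exists (Normc.normc c * (C1 * C2)) => x.
apply: (@le_trans _ _ (Normc.normc c * ((`|x.1| ^+ (a + i) * expR (- (Re z * x.1 ^+ 2))) *
  (`|x.2| ^+ (b + j) * expR (- (Re z * x.2 ^+ 2)))))); last first.
  rewrite ler_wpM2l ?normcRI ?sqrtr_ge0 //.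
  by rewrite ler_pM // mulr_ge0 ?exprn_ge0 ?expR_ge0.
have -> : x.1 ^+ a * x.2 ^+ b * gauss_mono c z i j x =
   x.1 ^+ (a + i) * x.2 ^+ (b + j) * Re (c * cgauss z x).
  by rewrite /gauss_mono !exprD; ring.
rewrite !normrM !normrX.
have hR : `|Re (c * cgauss z x)| <= Normc.normc c * expR (- (Re z * x.1 ^+ 2)) * expR (- (Re z * x.2 ^+ 2)).
  apply: (le_trans (normc_Re _)); rewrite normcM normc_cgauss -mulrA -expRD.
  by rewrite -opprD -mulrDr.
apply: (le_trans (ler_wpM2l _ hR)); first by rewrite mulr_ge0 ?exprn_ge0.
rewrite le_eqVlt; apply/orP; left; apply/eqP; ring.
Qed.

Lemma gauss_poly_bounded g : gauss_poly g -> forall a b, exists C : R, forall x : R * R,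
  `|x.1 ^+ a * x.2 ^+ b * g x| <= C.
Proof.
move=> hg a b; elim: hg => [|c z i j z0|f1 f2 _ [C1 h1] _ [C2 h2]].
- by exists 0 => x; rewrite mulr0 normr0.
- exact: gauss_mono_bounded.
- by exists (C1 + C2) => x; rewrite mulrDr (le_trans (ler_normD _ _)) // lerD.
Qed.

Lemma cont2D (f g : R * R -> R) : continuous f -> continuous g -> continuous (fun x => f x + g x).
Proof. by move=> cf cg x; apply: (@continuousD R R _ f g x); [exact: cf|exact: cg]. Qed.
Lemma cont2B (f g : R * R -> R) : continuous f -> continuous g -> continuous (fun x => f x - g x).
Proof. by move=> cf cg x; apply: (@continuousB R R _ f g x); [exact: cf|exact: cg]. Qed.
Lemma cont2M (f g : R * R -> R) : continuous f -> continuous g -> continuous (fun x => f x * g x).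
Proof. by move=> cf cg x; apply: (@continuousM R _ f g x); [exact: cf|exact: cg]. Qed.
Lemma cont2_comp (h : R -> R) (f : R * R -> R) : continuous h -> continuous f ->
  continuous (fun x => h (f x)).
Proof. by move=> ch cf x; apply: (@continuous_comp _ _ _ f h); [exact: cf|exact: ch]. Qed.
Lemma cont2_cst (k : R) : continuous (fun _ : R * R => k).
Proof. by move=> x; exact: cst_continuous. Qed.
Lemma cont2_fst : continuous (fun x : R * R => x.1). Proof. by move=> x; exact: cvg_fst. Qed.
Lemma cont2_snd : continuous (fun x : R * R => x.2). Proof. by move=> x; exact: cvg_snd. Qed.

Lemma continuous_cgauss z :
  continuous (fun x => Re (cgauss z x)) /\ continuous (fun x => Im (cgauss z x)).
Proof.
have cl (k : R) : continuous (fun x : R * R => k * (x.1 ^+ 2 + x.2 ^+ 2)).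
  apply: cont2M; first exact: cont2_cst.
  apply: cont2D; apply: (cont2_comp (h := fun t => t ^+ 2)); try exact: exprn_continuous.
    exact: cont2_fst.
  exact: cont2_snd.
have E x : cgauss z x = cexp ((- Re z * (x.1 ^+ 2 + x.2 ^+ 2)) +i* (- Im z * (x.1 ^+ 2 + x.2 ^+ 2)))%C.
  by congr cexp; apply: complexP; rewrite ?cReM ?cImM ?cReN ?cImN /=; ring.
have ce := cont2_comp (@continuous_expR R) (cl (- Re z)).
split.
  rewrite (_ : (fun x => _) = fun x => expR (- Re z * (x.1 ^+ 2 + x.2 ^+ 2)) * cos (- Im z * (x.1 ^+ 2 + x.2 ^+ 2))).
    by apply: cont2M => //; apply: cont2_comp (@continuous_cos R) (cl _).
  by apply/funext => x; rewrite E.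
rewrite (_ : (fun x => _) = fun x => expR (- Re z * (x.1 ^+ 2 + x.2 ^+ 2)) * sin (- Im z * (x.1 ^+ 2 + x.2 ^+ 2))).
  by apply: cont2M => //; apply: cont2_comp (@continuous_sin R) (cl _).
by apply/funext => x; rewrite E.
Qed.

Lemma gauss_poly_continuous g : gauss_poly g -> continuous g.
Proof.
elim=> [|c z i j z0|f1 f2 _ h1 _ h2].
- exact: cont2_cst.
- have [cR cI] := continuous_cgauss z.
  rewrite (_ : gauss_mono c z i j = fun x => x.1 ^+ i * x.2 ^+ j *
     (Re c * Re (cgauss z x) - Im c * Im (cgauss z x))); last first.
    by apply/funext => x; rewrite /gauss_mono cReM.
  apply: cont2M.
    apply: cont2M; apply: (cont2_comp (h := fun t => t ^+ _)); try exact: exprn_continuous.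
      exact: cont2_fst.
    exact: cont2_snd.
  by apply: cont2B; apply: cont2M => //; exact: cont2_cst.
- exact: cont2D.
Qed.

Lemma gauss_poly_partials g s : gauss_poly g -> gauss_poly (partials s g).
Proof.
move=> hg; elim: s => [//|i s IH] /=.
have [g' h' d'] := gauss_poly_derive (axis R i) IH.
rewrite (_ : partial i _ = g') //; apply/funext => x.
by rewrite /partial; apply: derive_val.
Qed.

Lemma gauss_poly_schwartzR g : gauss_poly g -> schwartzR g.
Proof.
move=> hg; split.
  move=> s; have hs := gauss_poly_partials s hg; split; first exact: gauss_poly_continuous.
  by move=> i x; have [g' _ d'] := gauss_poly_derive (axis R i) hs; case: (d' x).
by move=> a b s; apply: gauss_poly_bounded; exact: gauss_poly_partials.
Qed.

Lemma gauss_poly_sum I (r : seq I) (F : I -> R * R -> R) : (forall i, gauss_poly (F i)) ->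
  gauss_poly (fun x => \sum_(i <- r) F i x).
Proof.
move=> h; elim: r => [|i r IH].
  by under eq_fun do rewrite big_nil; exact: gauss_poly0.
by under eq_fun do rewrite big_cons; exact: gauss_polyD.
Qed.

Lemma schwartz_cgauss_sum I (r : seq I) (c z : I -> R[i]) : (forall i, 0 < Re (z i)) ->
  schwartz (fun x => \sum_(i <- r) c i * cgauss (z i) x).
Proof.
move=> z0; split; apply: gauss_poly_schwartzR.
  under eq_fun do rewrite Re_sum; apply: gauss_poly_sum => i.
  rewrite (_ : (fun x => _) = gauss_mono (c i) (z i) 0 0); first exact: gauss_polyM.
  by apply/funext => x; rewrite /gauss_mono !expr0 !mul1r.
under eq_fun do rewrite Im_sum; apply: gauss_poly_sum => i.
rewrite (_ : (fun x => _) = gauss_mono ((0 -i* 1)%C * c i) (z i) 0 0); first exact: gauss_polyM.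
apply/funext => x; rewrite /gauss_mono !expr0 !mul1r !(cReM, cImM) /=; ring.
Qed.
End Schwartz.

(** * The discrete Fourier transform of the sieve *)

Section DFT.
Context {R : realType}.
Local Notation Re := (@complex.Re R).
Local Notation Im := (@complex.Im R).
Implicit Types (q k n : nat).

Definition omega q : R[i] := expi (2 * pi / q%:R).

Lemma omegaX q n : omega q ^+ n = expi (2 * pi * n%:R / q%:R).
Proof.
elim: n => [|n IH].
  by rewrite expr0 mulr0 mul0r /expi cos0 sin0.
rewrite exprS IH /omega !expiE -cexpD; congr cexp; apply: complexP => /=; rewrite ?addr0 //.
by rewrite -[in RHS]natr1; ring.
Qed.

Lemma omega_neq0 q : omega q != 0.
Proof. by rewrite /omega expiE cexp_neq0. Qed.

(** If a power of omega with exponent i + 1 < q were 1, then cos (2 t) = 1 for some t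
    strictly between 0 and pi, where sin t > 0. *)
Lemma omega_prim q : (0 < q)%N -> q.-primitive_root (omega q).
Proof.
move=> q0; have qR : (q%:R : R) != 0 by rewrite pnatr_eq0 -lt0n.
apply/andP; split => //; apply/forallP => i; rewrite unity_rootE omegaX; apply/eqP.
have [iq|iq] := eqVneq i.+1 q.
  rewrite iq mulfK // /expi mulr_natl cos2pi sin2pi; exact: eqxx.
apply/negbTE/eqP => /(congr1 Re) /= c1.
have iq' : (i.+1 < q)%N by rewrite ltn_neqAle iq ltn_ord.
pose t : R := pi * i.+1%:R / q%:R.
have t0 : 0 < t by rewrite !mulr_gt0 ?pi_gt0 ?invr_gt0 ?ltr0n.
have tpi : t < pi.
  by rewrite /t -mulrA gtr_pMr ?pi_gt0 // ltr_pdivrMr ?ltr0n // mul1r ltr_nat.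
have s0 : 0 < sin t by apply: sin_gt0_pi; rewrite t0.
have : cos (t + t) = 1 by rewrite -c1; congr cos; rewrite /t; field.
have := cos2Dsin2 t; rewrite cosD; nra.
Qed.

Lemma sum_unity_root q (x : R[i]) : x ^+ q = 1 -> x != 1 -> \sum_(k < q) x ^+ k = 0.
Proof.
move=> xq x1; have := subrX1 x q; rewrite xq subrr => /esym/eqP.
by rewrite mulf_eq0 subr_eq0 (negbTE x1) /= => /eqP.
Qed.

Lemma sum_omega q (m n : nat) : (0 < q)%N ->
  \sum_(k < q) omega q ^+ (k * m) / omega q ^+ (k * n) = if m == n %[mod q] then q%:R else 0.
Proof.
move=> q0; have pr := omega_prim q0.
have w0 j : omega q ^+ j != 0 by rewrite expf_neq0 // omega_neq0.
pose x := omega q ^+ m / omega q ^+ n.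
have E k : omega q ^+ (k * m) / omega q ^+ (k * n) = x ^+ k.
  by rewrite /x expr_div_n -!exprM ![(_ * k)%N]mulnC.
under eq_bigr do rewrite E.
have x1 : (x == 1) = (m == n %[mod q]).
  by rewrite -(eq_prim_root_expr pr) /x -subr_eq0 -[RHS]subr_eq0 -{1}(divff (w0 n)) -mulrBl mulf_eq0 invr_eq0 (negbTE (w0 n)) orbF.
rewrite -x1; case: eqP => [->|/eqP ne].
  under eq_bigr do rewrite expr1n.
  by rewrite sumr_const card_ord.
apply: sum_unity_root => //.
by rewrite /x expr_div_n -!exprM ![(_ * q)%N]mulnC !exprM (prim_expr_order pr) !expr1n divr1.
Qed.

Variables (q : nat) (A : pred nat).
Hypothesis q0 : (0 < q)%N.
Hypothesis Aq : forall n, A (n %% q)%N = A n.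

(** The Fourier coefficients on Z/q of the indicator function of the complement of A. *)
Definition dft (k : nat) : R[i] := q%:R^-1 * \sum_(n < q | ~~ A n) (omega q ^+ (k * n))^-1.

Definition density : R := (\sum_(0 <= n < q | A n) 1)%:R / q%:R.

Lemma density_ge0 : 0 <= density. Proof. by rewrite divr_ge0. Qed.

Lemma qn0 : (q%:R : R[i]) != 0. Proof. by rewrite pnatr_eq0 -lt0n. Qed.

Lemma dft_inversion n : A n -> \sum_(k < q) dft k * omega q ^+ (k * n) = 0.
Proof.
move=> An.
under eq_bigr => k _.
  rewrite /dft -mulrA mulr_suml.
  under eq_bigr => m _ do rewrite mulrC.
  over.
rewrite -mulr_sumr exchange_big /= big1 ?mulr0 // => m nAm.
rewrite sum_omega //; case: ifP => // /eqP nm.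
by move: nAm; rewrite -Aq -nm Aq An.
Qed.

Lemma sum_complement : \sum_(n < q | ~~ A n) (1 : R[i]) = (q%:R * (1 - density)%:C%C).
Proof.
have h : (\sum_(n < q | A n) 1 + \sum_(n < q | ~~ A n) 1 = q)%N.
  by rewrite -(bigID (fun n : 'I_q => A n) predT (fun=> 1%N)) sum1_card card_ord.
have -> : \sum_(n < q | ~~ A n) (1 : R[i]) = (\sum_(n < q | ~~ A n) 1)%N%:R.
  by rewrite natr_sum.
rewrite /density big_mkord; move: h.
set a := (\sum_(n < q | A n) 1)%N; set b := (\sum_(n < q | ~~ A n) 1)%N => h.
have qR : (q%:R : R) != 0 by rewrite pnatr_eq0 -lt0n.
have hR : (q%:R : R) = a%:R + b%:R by rewrite -natrD h.
have -> : (1 - a%:R / q%:R : R) = b%:R / q%:R.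
  by rewrite -{1}(divff qR) -mulrBl hR addrAC subrr add0r.
by rewrite fmorph_div !rmorph_nat mulrC divfK // qn0.
Qed.

Lemma dft0 : dft 0 = (1 - density)%:C%C.
Proof.
rewrite /dft; under eq_bigr do rewrite mul0n expr0 invr1.
by rewrite sum_complement mulKf // qn0.
Qed.

Lemma conjc_omega j : ((omega q ^+ j)^*)%C = (omega q ^+ j)^-1.
Proof.
have h : (omega q)^*%C = (omega q)^-1.
  apply: (mulfI (omega_neq0 q)); rewrite divff ?omega_neq0 //.
  have := cos2Dsin2 (2 * pi / q%:R : R); rewrite /omega /expi => h.
  apply: complexP; rewrite ?cReM ?cImM [RHS]/=.
    by rewrite -[RHS]h /=; ring.
  by rewrite /=; ring.
transitivity ((omega q)^*%C ^+ j); first exact: rmorphXn.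
by rewrite h exprVn.
Qed.

Lemma conjc_dft k : ((dft k)^*)%C = q%:R^-1 * \sum_(n < q | ~~ A n) omega q ^+ (k * n).
Proof.
transitivity ((q%:R^-1)^*%C * (\sum_(n < q | ~~ A n) (omega q ^+ (k * n))^-1)^*%C).
  exact: rmorphM.
congr (_ * _); first by rewrite conjc_inv conjc_nat.
transitivity (\sum_(n < q | ~~ A n) ((omega q ^+ (k * n))^-1)^*%C); first exact: rmorph_sum.
by apply: eq_bigr => n _; rewrite -conjc_omega conjcK.
Qed.

Lemma dft_parseval : \sum_(k < q) Normc.normc (dft k) ^+ 2 = 1 - density.
Proof.
suff h : (\sum_(k < q) Normc.normc (dft k) ^+ 2)%:C%C = (1 - density)%:C%C by case: h.
rewrite rmorph_sum /=; under eq_bigr do rewrite normc_sqr.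
have E k : dft k * (dft k)^*%C = q%:R^-1 * (q%:R^-1 * \sum_(m < q | ~~ A m) \sum_(n < q | ~~ A n)
   (omega q ^+ (k * n) / omega q ^+ (k * m))).
  rewrite conjc_dft /dft.
  rewrite mulrACA -mulrA mulr_suml; congr (_ * (_ * _)); apply: eq_bigr => m _.
  by rewrite mulr_sumr; apply: eq_bigr => n _; rewrite mulrC.
under eq_bigr do rewrite E.
rewrite -!mulr_sumr exchange_big /=.
have -> : \sum_(m < q | ~~ A m) \sum_(k < q) \sum_(n < q | ~~ A n) omega q ^+ (k * n) / omega q ^+ (k * m)
   = \sum_(m < q | ~~ A m) q%:R.
  apply: eq_bigr => m Am; rewrite exchange_big /= (bigD1 m) //= sum_omega // eqxx.
  rewrite big1 ?addr0 // => n /andP[_ nm]; rewrite sum_omega //.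
  by rewrite !modn_small // (inj_eq val_inj) (negbTE nm).
under eq_bigr do rewrite -[q%:R]mulr1.
by rewrite -mulr_sumr sum_complement mulKf ?qn0 // mulKf ?qn0.
Qed.

(** By Parseval the sum over all k is 1 - s, with s the density of A; removing the term
    (1 - s)^2 at k = 0 leaves s (1 - s). *)
Lemma dft_l2 : \sum_(k < q | k != Ordinal q0) Normc.normc (dft k) ^+ 2 <= density.
Proof.
have := dft_parseval; rewrite (bigD1 (Ordinal q0)) //= dft0 normcRI /= expr0n addr0 sqr_sqrtr ?sqr_ge0 //.
move: (\sum_(k < q | _) _) => S h; have := density_ge0; move: density h => s h s0; nra.
Qed.
End DFT.

(** * Square integrals of sums of complex Gaussians *)

Section SquareIntegral.
Context {R : realType}.
Local Notation mu2 := (@lebesgue_measure R \x @lebesgue_measure R)%E.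
Local Notation Re := (@complex.Re R).
Local Notation Im := (@complex.Im R).

Definition sqn (x : R * R) : R := x.1 ^+ 2 + x.2 ^+ 2.

Lemma conj_cgauss (z : R[i]) x : (cgauss z x)^*%C = cgauss z^*%C x.
Proof.
have h (w : R[i]) : (cexp w)^*%C = cexp w^*%C.
  by case: w => a b; rewrite /cexp /= cosN sinN mulrN.
rewrite /cgauss h; congr cexp; case: z => a b; apply: complexP => /=; ring.
Qed.

Lemma cgaussD (z w : R[i]) x : cgauss (z + w) x = cgauss z x * cgauss w x.
Proof. by rewrite /cgauss -cexpD; congr cexp; ring. Qed.

Lemma cgauss_real (a : R) x : cgauss a%:C%C x = (expR (- (a * sqn x)))%:C%C.
Proof.
rewrite /cgauss /cexp /sqn; apply: complexP.
  by rewrite /= oppr0 !mul0r !mulr0 subr0 addr0 cos0 mulr1 mulNr.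
by rewrite /= oppr0 !mul0r !mulr0 addr0 sin0 mulr0.
Qed.

(** Expanding the square produces a double sum of complex Gaussians, each of which has
    integral pi over its exponent.  The weight exp (b |x|^2) is what will turn an L^2
    bound into an L^p bound. *)
Lemma gauss_sum_sqr_int (I : finType) (C z : I -> R[i]) (b : R) :
  (forall k, b < 2 * Re (z k)) ->
  let r := fun x => Normc.normc (\sum_k C k * cgauss (z k) x) ^+ 2 * expR (b * sqn x) in
  mu2.-integrable setT (fun x => (r x)%:E) /\
  \int[mu2]_x r x <= \sum_k \sum_l
    Normc.normc (C k) * Normc.normc (C l) * (pi / Normc.normc (z k + (z l)^*%C - b%:C%C)).
Proof.
move=> hb r.
pose zz k l := z k + (z l)^*%C - b%:C%C.
have zz0 k l : 0 < Re (zz k l).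
  rewrite /zz cReD cReN cReD /=.
  have -> : Re (z l)^*%C = Re (z l) by case: (z l).
  by have := hb k; have := hb l; lra.
have iz k l : Cintegrable mu2 (fun x => C k * (C l)^*%C * cgauss (zz k l) x).
  by apply: CintegrableZ; have [] := cgauss_int (zz0 k l).
have rE x : (r x)%:C%C = \sum_k \sum_l C k * (C l)^*%C * cgauss (zz k l) x.
  rewrite /r rmorphM /= normc_sqr.
  have -> : (\sum_k C k * cgauss (z k) x)^*%C = \sum_l (C l)^*%C * cgauss (z l)^*%C x.
    transitivity (\sum_l (C l * cgauss (z l) x)^*%C); first exact: rmorph_sum.
    by apply: eq_bigr => l _; rewrite -conj_cgauss; exact: rmorphM.
  have -> : (expR (b * sqn x))%:C%C = cgauss (- b%:C%C) x.
    by rewrite -rmorphN cgauss_real mulNr opprK.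
  rewrite mulr_suml mulr_suml; apply: eq_bigr => k _.
  rewrite mulr_sumr mulr_suml; apply: eq_bigr => l _.
  by rewrite /zz !cgaussD; ring.
have i2 : Cintegrable mu2 (fun x => (r x)%:C%C).
  by under eq_fun do rewrite rE; do 2! apply: Cintegrable_sum => ?.
have e2 : Cint mu2 (fun x => (r x)%:C%C) = \sum_k \sum_l C k * (C l)^*%C * (pi%:C%C / zz k l).
  rewrite (eq_Cint mu2 rE) Cint_sum; last by move=> k; apply: Cintegrable_sum.
  apply: eq_bigr => k _; rewrite Cint_sum //; apply: eq_bigr => l _.
  have [i e] := cgauss_int (zz0 k l).
  by rewrite CintZ // e.
split; first by case: i2.
have -> : \int[mu2]_x r x = Re (Cint mu2 (fun x => (r x)%:C%C)) by [].
rewrite e2; apply: le_trans (ler_norm _) _; apply: le_trans (normc_Re _) _.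
apply: le_trans (normc_sum _ _) _; apply: ler_sum => k _.
apply: le_trans (normc_sum _ _) _; apply: ler_sum => l _.
rewrite !normcM normc_conj Normc.normcV -/(zz k l).
rewrite (_ : Normc.normc pi%:C%C = pi) //.
by rewrite normcRI /= expr0n addr0 sqrtr_sqr ger0_norm // pi_ge0.
Qed.
End SquareIntegral.

Section Estimate.
Context {R : realType}.
Local Notation mu2 := (@lebesgue_measure R \x @lebesgue_measure R)%E.
Local Notation Re := (@complex.Re R).
Local Notation Im := (@complex.Im R).

(** The difference is (x - y) (e^2 - x y) over the product of the two denominators, where
    |x - y| >= 2 / Q, x y - e^2 >= 3 / Q^2 and both denominators are at most 5.  This
    separates the rates of oscillation of the chirps uniformly in e. *)
Lemma inverse_gap (Q e x y : R) : 1 <= Q -> 0 < e -> e <= Q^-1 ->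
  2 / Q <= x -> x <= 2 -> 2 / Q <= y -> y <= 2 -> 2 / Q <= `|x - y| ->
  (5 * Q ^+ 3)^-1 <= `|x / (e ^+ 2 + x ^+ 2) - y / (e ^+ 2 + y ^+ 2)|.
Proof.
move=> Q1 e0 eQ x1 x2 y1 y2 xy.
have Q0 : 0 < Q by lra.
set t := Q^-1 in eQ x1 y1 xy *; have t0 : 0 < t by rewrite invr_gt0.
have t1 : t <= 1 by rewrite invf_le1.
have xp : 0 < x by apply: lt_le_trans x1; rewrite mulr_gt0.
have yp : 0 < y by apply: lt_le_trans y1; rewrite mulr_gt0.
have ee : e ^+ 2 <= t ^+ 2 by rewrite lerXn2r ?nnegrE // ltW.
have e1 : e ^+ 2 <= 1 by apply: le_trans ee _; rewrite expr_le1 // ltW.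
have Dx : 0 < e ^+ 2 + x ^+ 2 <= 5.
  by rewrite ltr_pwDl ?exprn_gt0 ?sqr_ge0 //=; have : x ^+ 2 <= 2 ^+ 2 by [rewrite lerXn2r ?nnegrE // ltW|]; lra.
have Dy : 0 < e ^+ 2 + y ^+ 2 <= 5.
  by rewrite ltr_pwDl ?exprn_gt0 ?sqr_ge0 //=; have : y ^+ 2 <= 2 ^+ 2 by [rewrite lerXn2r ?nnegrE // ltW|]; lra.
case/andP: Dx => Dx0 Dx5; case/andP: Dy => Dy0 Dy5.
have -> : x / (e ^+ 2 + x ^+ 2) - y / (e ^+ 2 + y ^+ 2) =
   (x - y) * (e ^+ 2 - x * y) / ((e ^+ 2 + x ^+ 2) * (e ^+ 2 + y ^+ 2)).
  by field; rewrite !gt_eqF.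
rewrite normf_div normrM (gtr0_norm (mulr_gt0 Dx0 Dy0)).
have h1 : 3 * t ^+ 2 <= `|e ^+ 2 - x * y|.
  have : (2 * t) * (2 * t) <= x * y by rewrite ler_pM // mulr_ge0 // ltW.
  by rewrite distrC => h; apply: le_trans (ler_norm _); lra.
have h2 : (2 * t) * (3 * t ^+ 2) <= `|x - y| * `|e ^+ 2 - x * y|.
  by rewrite ler_pM // ?mulr_ge0 ?sqr_ge0 // ltW.
rewrite ler_pdivlMr ?mulr_gt0 //; apply: le_trans h2.
have h3 : (e ^+ 2 + x ^+ 2) * (e ^+ 2 + y ^+ 2) <= 25.
  by apply: (@le_trans _ _ (5 * 5)); [rewrite ler_pM // ltW|lra].
have -> : (5 * Q ^+ 3)^-1 = t ^+ 3 / 5 by rewrite /t; field; rewrite gt_eqF.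
have t30 : 0 < t ^+ 3 by rewrite exprn_gt0.
have : t ^+ 3 / 5 * ((e ^+ 2 + x ^+ 2) * (e ^+ 2 + y ^+ 2)) <= t ^+ 3 / 5 * 25.
  by rewrite ler_wpM2l // divr_ge0 // ltW.
have -> : 2 * t * (3 * t ^+ 2) = 6 * t ^+ 3 by ring.
lra.
Qed.

Variables (q : nat) (A : pred nat).
Hypothesis q0 : (0 < q)%N.
Variable e : R.
Hypothesis e0 : 0 < e.
Hypothesis eq' : e <= (q%:R)^-1.

Definition tau (k : nat) : R := 2 * k%:R / q%:R.
Definition wden (k : nat) : R := e ^+ 2 + tau k ^+ 2.
(** The inverse of the complex width e - i tau k, by [winvV]. *)
Definition winv (k : nat) : R[i] := (e / wden k +i* (tau k / wden k))%C.

Lemma q_ge1 : (1 : R) <= q%:R. Proof. by rewrite ler1n. Qed.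
Lemma qR0 : 0 < (q%:R : R). Proof. by rewrite ltr0n. Qed.

Lemma e_le1 : e <= 1.
Proof. by apply: le_trans eq' _; rewrite invf_le1 ?qR0 ?q_ge1. Qed.

Lemma wden_gt0 k : 0 < wden k.
Proof. by rewrite ltr_pwDl ?exprn_gt0 ?sqr_ge0. Qed.

Lemma tau_bounds k : (k < q)%N -> 0 <= tau k <= 2.
Proof.
move=> kq; rewrite /tau mulr_ge0 ?mulr_ge0 ?invr_ge0 //= -mulrA ler_piMr //.
by rewrite ler_pdivrMr ?qR0 // mul1r ler_nat ltnW.
Qed.

Lemma wden_le5 k : (k < q)%N -> wden k <= 5.
Proof.
move=> /tau_bounds /andP[t0 t2]; rewrite /wden.
have : tau k ^+ 2 <= 2 ^+ 2 by rewrite lerXn2r ?nnegrE.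
have : e ^+ 2 <= 1 by rewrite expr_le1 // ?e_le1 // ltW.
lra.
Qed.

Lemma winvV k : winv k * (e -i* tau k)%C = 1.
Proof.
have := wden_gt0 k; rewrite /winv /wden => d0.
apply: complexP; rewrite ?cReM ?cImM /=; field; rewrite gt_eqF //.
Qed.

Lemma winv_neq0 k : winv k != 0.
Proof. by apply/eqP => h; have := winvV k; rewrite h mul0r => /esym/eqP; rewrite oner_eq0. Qed.

Lemma normc_winv k : Normc.normc (winv k) ^+ 2 = (wden k)^-1.
Proof.
have := wden_gt0 k; rewrite normcRI sqr_sqrtr ?addr_ge0 ?sqr_ge0 //= /wden => d0.
by field; rewrite gt_eqF.
Qed.

Lemma tau_ge k : (0 < k)%N -> 2 / q%:R <= tau k.
Proof.
move=> k0; rewrite /tau -mulrA [k%:R * _]mulrC mulrA.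
by rewrite ler_peMr ?divr_ge0 // ler1n.
Qed.

Lemma normc_winv_le k : (0 < k)%N -> Normc.normc (winv k) <= q%:R.
Proof.
move=> k0; rewrite -(@ler_pXn2r _ 2) ?nnegrE ?normc_ge0 // normc_winv.
have qp := qR0.
have h : q%:R ^- 2 <= wden k.
  have h1 := tau_ge k0.
  have h2 : 0 <= 2 / q%:R :> R by rewrite divr_ge0.
  have : (2 / q%:R) ^+ 2 <= tau k ^+ 2 :> R by rewrite lerXn2r ?nnegrE // (le_trans h2).
  rewrite /wden exprMn exprVn; have : 0 < (q%:R ^- 2 : R) by rewrite invr_gt0 exprn_gt0.
  have := sqr_ge0 e; lra.
by rewrite -[leRHS]invrK lef_pV2 ?posrE ?invr_gt0 ?exprn_gt0 ?wden_gt0.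
Qed.

Lemma normc_dft_le1 k : (k < q)%N -> Normc.normc (dft q A k : R[i]) <= 1.
Proof.
move=> kq; rewrite -(@ler_pXn2r _ 2) ?nnegrE ?normc_ge0 // expr1n.
apply: (@le_trans _ _ (1 - density q A)); last by rewrite lerBlDr lerDl density_ge0.
rewrite -(@dft_parseval R q A q0) (bigD1 (Ordinal kq)) //= lerDl.
by apply: sumr_ge0 => i _; rewrite sqr_ge0.
Qed.

(** The coefficient at k = 0, that of the concentrated Gaussian, is replaced by 0. *)
Definition remainder_coef (k : 'I_q) : R[i] := if k == Ordinal q0 then 0 else dft q A k * winv k.
Definition gexp (k : nat) : R[i] := pi%:C%C * winv k.

Lemma Re_gexp k : Re (gexp k) = pi * e / wden k.
Proof. by rewrite /gexp cReM /= mul0r subr0 mulrA. Qed.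
Lemma Im_gexp k : Im (gexp k) = pi * (tau k / wden k).
Proof. by rewrite /gexp cImM /= mul0r addr0. Qed.
Lemma Re_gexp_gt0 k : 0 < Re (gexp k).
Proof. by rewrite Re_gexp divr_gt0 ?wden_gt0 // mulr_gt0 // pi_gt0. Qed.

Variable b : R.
Hypothesis b0 : 0 <= b.
Hypothesis b5 : 5 * b <= pi * e.

Lemma b_le k : (k < q)%N -> b <= pi * e / wden k.
Proof.
move=> kq; rewrite ler_pdivlMr ?wden_gt0 //; apply: le_trans b5.
by rewrite mulrC ler_wpM2r // wden_le5.
Qed.

Lemma ord_neq0 (k : 'I_q) : k != Ordinal q0 -> (0 < k)%N.
Proof. by rewrite lt0n; apply: contraNneq => k0; apply/eqP; exact: val_inj. Qed.

(** The terms of the double sum in [gauss_sum_sqr_int]. *)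
Definition pair_bound (k l : 'I_q) : R := Normc.normc (remainder_coef k) * Normc.normc (remainder_coef l) *
    (pi / Normc.normc (gexp k + (gexp l)^*%C - b%:C%C)).

(** On the diagonal the exponent is real and at least pi e / wden k, and the square of
    the norm of winv k is 1 / wden k, so that wden k cancels. *)
Lemma pair_bound_diag k : pair_bound k k <= if k == Ordinal q0 then 0 else Normc.normc (dft q A k : R[i]) ^+ 2 / e.
Proof.
rewrite /pair_bound /remainder_coef; case: eqP => [_|_]; first by rewrite Normc.normc0 !mul0r.
have d0 := wden_gt0 k; have p0 := pi_gt0 R.
have bk := b_le (ltn_ord k).
have h : pi * e / wden k <= Normc.normc (gexp k + (gexp k)^*%C - b%:C%C).
  apply: le_trans (normc_Re _); apply: le_trans (ler_norm _).
  rewrite cReD cReN cReD.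
  have -> : Re (gexp k)^*%C = Re (gexp k) by case: (gexp k).
  rewrite Re_gexp [complex.Re b%:C%C]/=; lra.
have h0 : 0 < pi * e / wden k by rewrite divr_gt0 // mulr_gt0.
rewrite -expr2 normcM exprMn normc_winv -mulrA ler_wpM2l ?sqr_ge0 //.
apply: (@le_trans _ _ ((wden k)^-1 * (pi / (pi * e / wden k)))).
  rewrite ler_wpM2l ?invr_ge0 ?(ltW d0) // ler_wpM2l ?(ltW p0) //.
  by rewrite lef_pV2 ?posrE // (lt_le_trans h0).
rewrite le_eqVlt; apply/orP; left; apply/eqP.
by move: (pi : R) p0 => P p0; field; rewrite !gt_eqF.
Qed.

(** Off the diagonal the imaginary part of the exponent is a difference of two distinct
    rates, which [inverse_gap] bounds below independently of e. *)
Lemma pair_bound_off k l : k != l -> pair_bound k l <= 5 * q%:R ^+ 5.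
Proof.
move=> kl; rewrite /pair_bound /remainder_coef.
have qp := qR0; have p0 := pi_gt0 R.
have r0 : 0 <= 5 * q%:R ^+ 5 :> R by rewrite mulr_ge0 // exprn_ge0.
case: eqP => [_|/eqP/ord_neq0 k0]; first by rewrite Normc.normc0 !mul0r.
case: eqP => [_|/eqP/ord_neq0 l0]; first by rewrite Normc.normc0 mulr0 !mul0r.
have hI : pi / (5 * q%:R ^+ 3) <= Normc.normc (gexp k + (gexp l)^*%C - b%:C%C).
  apply: le_trans (normc_Im _).
  rewrite cImD cImN cImD [complex.Im b%:C%C]/=.
  have -> : Im (gexp l)^*%C = - Im (gexp l) by case: (gexp l).
  rewrite !Im_gexp oppr0 addr0 -mulrBr normrM (gtr0_norm p0) ler_wpM2l ?(ltW p0) //.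
  have /andP[_ k2] := tau_bounds (ltn_ord k); have /andP[_ l2] := tau_bounds (ltn_ord l).
  apply: inverse_gap => //; rewrite ?q_ge1 ?tau_ge //.
  have -> : tau k - tau l = 2 / q%:R * (k%:R - l%:R) by rewrite /tau; ring.
  rewrite normrM ger0_norm ?divr_ge0 // ler_peMr ?divr_ge0 //.
  wlog lk : k l kl {k0 l0 k2 l2} / (k <= l)%N.
    move=> W; have [/W -> //|/ltnW /W] := leqP k l.
    by rewrite distrC; apply; rewrite eq_sym.
  have {}lk : (k < l)%N by rewrite ltn_neqAle lk andbT (inj_eq val_inj).
  by rewrite distrC -natrB ?(ltnW lk) // normr_nat ler1n subn_gt0.
have hp : 0 < pi / (5 * q%:R ^+ 3) :> R by rewrite divr_gt0 // mulr_gt0 // exprn_gt0.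
have hk : Normc.normc (dft q A k * winv k) <= q%:R.
  rewrite normcM -[leRHS]mul1r ler_pM ?normc_ge0 ?normc_dft_le1 ?normc_winv_le //.
have hl : Normc.normc (dft q A l * winv l) <= q%:R.
  rewrite normcM -[leRHS]mul1r ler_pM ?normc_ge0 ?normc_dft_le1 ?normc_winv_le //.
apply: (@le_trans _ _ (q%:R * q%:R * (pi / (pi / (5 * q%:R ^+ 3))))).
  apply: ler_pM; rewrite ?mulr_ge0 ?normc_ge0 ?invr_ge0 ?(ltW p0) ?normc_ge0 //.
    by apply: ler_pM; rewrite ?normc_ge0.
  rewrite ler_wpM2l ?(ltW p0) //.
  by rewrite lef_pV2 ?posrE // (lt_le_trans hp).
rewrite le_eqVlt; apply/orP; left; apply/eqP.
by move: (pi : R) p0 => P p0; field; rewrite !gt_eqF.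
Qed.

Lemma pair_bound_sum : \sum_k \sum_l pair_bound k l <= density q A / e + 5 * q%:R ^+ 7.
Proof.
apply: (@le_trans _ _ (\sum_(k < q) ((if k == Ordinal q0 then 0
     else Normc.normc (dft q A k : R[i]) ^+ 2 / e) + 5 * q%:R ^+ 6))).
  apply: ler_sum => k _; rewrite (bigD1 k) //= lerD ?pair_bound_diag //.
  apply: (@le_trans _ _ (\sum_(l < q | l != k) 5 * q%:R ^+ 5)).
    by apply: ler_sum => l lk; apply: pair_bound_off; rewrite eq_sym.
  apply: (@le_trans _ _ (\sum_(l < q) 5 * q%:R ^+ 5)).
    rewrite big_mkcond; apply: ler_sum => l _; case: ifP => // _.
  by rewrite sumr_const card_ord -[leLHS]mulr_natr -mulrA -exprSr.
rewrite big_split /= lerD //; last first.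
  by rewrite sumr_const card_ord -[leLHS]mulr_natr -mulrA -exprSr.
have -> : \sum_(k < q) (if k == Ordinal q0 then 0 else Normc.normc (dft q A k : R[i]) ^+ 2 / e)
   = (\sum_(k < q | k != Ordinal q0) Normc.normc (dft q A k : R[i]) ^+ 2) / e.
  rewrite [in RHS]big_mkcond mulr_suml; apply: eq_bigr => k _; case: eqP => //=.
  by rewrite mul0r.
by rewrite ler_wpM2r ?invr_ge0 ?(ltW e0) // dft_l2.
Qed.

Definition remainder (x : R * R) : R[i] := \sum_(k < q) remainder_coef k * cgauss (gexp k) x.

(** The terms of the remainder are almost orthogonal: only the diagonal grows as e tends
    to 0. *)
Lemma remainder_sqr_int :
  mu2.-integrable setT (fun x => (Normc.normc (remainder x) ^+ 2 * expR (b * sqn x))%:E) /\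
  \int[mu2]_x (Normc.normc (remainder x) ^+ 2 * expR (b * sqn x)) <= density q A / e + 5 * q%:R ^+ 7.
Proof.
have hb (k : 'I_q) : b < 2 * Re (gexp k).
  have := b_le (ltn_ord k); rewrite Re_gexp; have := Re_gexp_gt0 k; rewrite Re_gexp; lra.
have [i le] := gauss_sum_sqr_int remainder_coef hb.
split => //; apply: (le_trans le); exact: pair_bound_sum.
Qed.

Lemma remainder_le x : Normc.normc (remainder x) <= q%:R ^+ 2.
Proof.
apply: le_trans (normc_sum _ _) _.
apply: (@le_trans _ _ (\sum_(k < q) (q%:R : R))).
  apply: ler_sum => k _; rewrite /remainder_coef normcM.
  case: eqP => [_|/eqP/ord_neq0 k0]; first by rewrite Normc.normc0 mul0r.
  rewrite -[leRHS]mulr1 ler_pM ?normc_ge0 //.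
    by rewrite normcM -[leRHS]mul1r ler_pM ?normc_ge0 ?normc_dft_le1 ?normc_winv_le.
  rewrite normc_cgauss -[leRHS]expR0 ler_expR oppr_le0 mulr_ge0 ?(ltW (Re_gexp_gt0 _)) //.
  by rewrite addr_ge0 ?sqr_ge0.
by rewrite sumr_const card_ord -[leLHS]mulr_natr expr2.
Qed.

Definition sieved_gauss (x : R * R) : R[i] := \sum_(k < q) (dft q A k * winv k) * cgauss (gexp k) x.

(** The term k = 0 has width e and is a real Gaussian concentrated near the origin. *)
Lemma sieved_gaussE x : sieved_gauss x = ((1 - density q A) / e * expR (- (pi / e * sqn x)))%:C%C + remainder x.
Proof.
rewrite /sieved_gauss /remainder (bigD1 (Ordinal q0)) //= [in RHS](bigD1 (Ordinal q0)) //=.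
have c0 : remainder_coef (Ordinal q0) = 0 by rewrite /remainder_coef eqxx.
rewrite c0 mul0r add0r; congr (_ + _); last first.
  by apply: eq_bigr => k k0; rewrite /remainder_coef (negbTE k0).
have u0 : winv 0 = (e^-1)%:C%C.
  rewrite /winv /wden /tau mulr0 mul0r expr0n addr0 mul0r.
  by congr (_ +i* _)%C; field; rewrite gt_eqF.
rewrite dft0 // /gexp u0 -!rmorphM /= cgauss_real -rmorphM //.
Qed.
End Estimate.

(** * Bounds for conjugate Lebesgue norms *)

Section LnormBounds.
Context {d : measure_display} {T : measurableType d} {R : realType}.
Variable mu : {measure set T -> \bar R}.

Lemma Lnorm_le_dominated (f H : T -> R) (p B : R) : 0 < p ->
  (forall x, 0 <= f x) ->
  measurable_fun setT f -> (forall x, f x `^ p <= H x) ->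
  mu.-integrable setT (fun x => (H x)%:E) -> \int[mu]_x H x <= B ->
  ('N[mu]_p%:E[(fun x => (f x)%:E)] <= (B `^ p^-1)%:E)%E.
Proof.
move=> p0 f0 mf fH iH HB; rewrite unlock -poweR_EFin.
have H0 x : 0 <= H x := le_trans (powR_ge0 _ _) (fH x).
have le : (\int[mu]_x (`|(f x)%:E| `^ p)%E <= B%:E)%E.
  apply: (@le_trans _ _ (\int[mu]_x (H x)%:E)%E).
    apply: ge0_le_integral => //.
    - by move=> x _; exact: poweR_ge0.
    - apply: (measurableT_comp (measurable_poweR _)) => //.
      by apply: measurableT_comp => //; exact/measurable_EFinP.
    - exact: (measurable_int mu).
    by move=> x _; rewrite abse_EFin poweR_EFin lee_fin ger0_norm.
  by rewrite -(fineK (integrable_fin_num measurableT iH)) lee_fin.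
have i0 : (0 <= \int[mu]_x (`|(f x)%:E| `^ p)%E)%E by apply: integral_ge0 => x _; exact: poweR_ge0.
apply: gt0_ler_poweR => //; rewrite ?invr_ge0 ?(ltW p0) //.
  by rewrite in_itv /= i0 leey.
by rewrite in_itv /= (le_trans i0) ?leey.
Qed.

(** The norm is at least that of c times the indicator of Q.  In terms of p the result
    covers p = 1, where the conjugate norm is an essential supremum. *)
Lemma Lnorm_conj_ge (f : T -> R) (p c m : R) (Q : set T) : 1 <= p -> 0 < c -> 0 < m ->
  (forall x, 0 <= f x) -> measurable_fun setT f -> measurable Q -> mu Q = m%:E ->
  (forall x, Q x -> c <= f x) ->
  ((c * m `^ (1 - p^-1))%:E <= 'N[mu]_(hoelder_conjugate p%:E)[(fun x => (f x)%:E)])%E.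
Proof.
move=> p1 c0 m0 f0 mf mQ muQ fc.
have muT : (0 < mu setT)%E.
  have QT : (mu Q <= mu setT)%E by apply: le_measure; rewrite ?inE.
  by apply: lt_le_trans QT; rewrite muQ lte_fin.
move: p1; rewrite le_eqVlt => /orP[/eqP p1|p1].
  rewrite -p1 hoelder_conjugate1 invr1 subrr powRr0 mulr1 unlock muT.
  rewrite leNgt; apply/negP => lt.
  have [N [mN N0 sN]] := ess_sup_ge mu (abse \o (fun x => (f x)%:E)).
  have QN : Q `<=` N.
    move=> x Qx; apply: sN => /= le; have := le_lt_trans le lt.
    by rewrite lte_fin ger0_norm // ltNge fc.
  have : (mu Q <= mu N)%E by apply: le_measure; rewrite ?inE.
  by rewrite N0 muQ lee_fin leNgt m0.
have p0 : 0 < p by lra.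
have pm : 0 < p - 1 by lra.
have -> : hoelder_conjugate p%:E = (p / (p - 1))%:E.
  rewrite /hoelder_conjugate /= eqe gt_eqF // -EFinB inver gt_eqF //.
set r := p / (p - 1); have r0 : 0 < r by rewrite divr_gt0.
have ri : 1 - p^-1 = r^-1 by rewrite /r invf_div mulrBl divff ?gt_eqF // mul1r.
rewrite unlock ri.
have -> : (c * m `^ r^-1)%:E = ((c `^ r * m)%:E `^ r^-1)%E.
  rewrite poweR_EFin powRM ?powR_ge0 ?(ltW m0) // -powRrM divff ?gt_eqF // powRr1 // ltW //.
have i0 : (0 <= \int[mu]_x (`|(f x)%:E| `^ r)%E)%E by apply: integral_ge0 => x _; exact: poweR_ge0.
apply: gt0_ler_poweR => //; rewrite ?invr_ge0 ?(ltW r0) //.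
- by rewrite in_itv /= leey andbT lee_fin mulr_ge0 ?powR_ge0 // ltW.
- by rewrite in_itv /= i0 leey.
have mF : measurable_fun setT (fun x => `|(f x)%:E| `^ r)%E.
  apply: (measurableT_comp (measurable_poweR _)) => //.
  by apply: measurableT_comp => //; exact/measurable_EFinP.
apply: (@le_trans _ _ (\int[mu]_(x in Q) (`|(f x)%:E| `^ r)%E)%E); last first.
  apply: ge0_subset_integral => //.
  by move=> x _; exact: poweR_ge0.
apply: (@le_trans _ _ (\int[mu]_(x in Q) (c `^ r)%:E)%E).
  by rewrite integral_cst // EFinM muQ.
apply: ge0_le_integral => //.
- by move=> x _; rewrite lee_fin powR_ge0.
- exact: measurable_funTS.
move=> x Qx; rewrite abse_EFin poweR_EFin lee_fin ge0_ler_powR ?nnegrE ?(ltW r0) ?(ltW c0) //.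
by rewrite ger0_norm //; exact: fc.
Qed.
End LnormBounds.

(** * The sieved Gaussian lies in X_2 *)

Section Test.
Context {R : realType}.
Local Notation mu2 := (@lebesgue_measure R \x @lebesgue_measure R)%E.
Local Notation Re := (@complex.Re R).
Local Notation Im := (@complex.Im R).
Variables (q : nat) (A : pred nat).
Hypothesis q0 : (0 < q)%N.
Hypothesis Aq : forall n, A (n %% q)%N = A n.
Hypothesis A2 : forall a b, A (a ^ 2 + b ^ 2)%N.
Variable e : R.
Hypothesis e0 : 0 < e.
Local Notation f := (sieved_gauss q A e).

Lemma sieved_gauss_schwartz : schwartz f.
Proof. by apply: schwartz_cgauss_sum => k; exact: Re_gexp_gt0. Qed.

Lemma sieved_gauss_integrable : integrableC f.
Proof.
suff : Cintegrable mu2 f by [].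
apply: Cintegrable_sum => k; apply: CintegrableZ.
by have [] := cgauss_int (Re_gexp_gt0 q e0 k).
Qed.

(** The transform of exp (- pi |x|^2 / w) / w is exp (- pi w |xi|^2), and w = e - i tau k
    contributes the phase 2 pi k |xi|^2 / q. *)
Lemma sieved_gauss_fourier xi : fourier f xi =
  (expR (- (pi * e * sqn xi)))%:C%C *
   \sum_(k < q) dft q A k * expi (2 * pi * k%:R / q%:R * sqn xi).
Proof.
pose E x := expi (- (2 * pi * dot x xi)) : R[i].
have h k := cgauss_fourier xi (Re_gexp_gt0 q e0 k).
transitivity (Cint mu2 (fun x => \sum_(k < q) (dft q A k * winv q e k) * (cgauss (gexp q e k) x * E x))).
  apply: (@eq_Cint _ _ _ mu2) => x; rewrite mulr_suml; apply: eq_bigr => k _.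
  by rewrite mulrA.
rewrite Cint_sum; last by move=> k; apply: CintegrableZ; have [] := h k.
rewrite mulr_sumr; apply: eq_bigr => k _.
have [i c] := h k; rewrite CintZ // c /gexp -/(sqn xi).
have u0 := winv_neq0 q e0 k.
have p0 : (pi%:C%C : R[i]) != 0 by rewrite fmorph_eq0 gt_eqF // pi_gt0.
have uV : (winv q e k)^-1 = (e -i* tau q k)%C.
  by apply: (mulfI u0); rewrite divff // winvV.
have -> : - (pi ^+ 2 * sqn xi)%:C%C / (pi%:C%C * winv q e k) = (- (pi * sqn xi))%:C%C * (e -i* tau q k)%C.
  have hP (P s : R) : P != 0 -> - (P ^+ 2 * s) / P = - (P * s) by move=> ?; field.
  rewrite -uV invfM mulrA; congr (_ * _).
  by rewrite -rmorphN -fmorph_div hP // gt_eqF // pi_gt0.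
have -> : cexp ((- (pi * sqn xi))%:C%C * (e -i* tau q k)%C) =
   (expR (- (pi * e * sqn xi)))%:C%C * expi (2 * pi * k%:R / q%:R * sqn xi).
  rewrite expiE.
  have -> : (expR (- (pi * e * sqn xi)))%:C%C = cexp ((- (pi * e * sqn xi))%:C)%C.
    by rewrite /cexp /= cos0 sin0 mulr1 mulr0.
  rewrite -cexpD; congr cexp; apply: complexP; rewrite ?cReD ?cImD ?cReM ?cImM /= /tau; ring.
have -> : pi%:C%C / (pi%:C%C * winv q e k) = (winv q e k)^-1 by rewrite invfM mulVKf.
rewrite mulrA [X in X * _ = _]mulfK //.
by rewrite mulrCA.
Qed.

(** At |xi|^2 = k^2 + l^2, an element of A, the sum over the frequencies is the value of
    the indicator of the complement of A. *)
Lemma sieved_gauss_X2 : X2 f.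
Proof.
split; first exact: sieved_gauss_integrable.
move=> r k l hr; rewrite sieved_gauss_fourier.
pose n := (`|k| ^ 2 + `|l| ^ 2)%N.
have hn : sqn r = n%:R.
  have h0 : 0 <= ((l ^+ 2 + k ^+ 2)%:~R : R) by rewrite ler0z addr_ge0 ?sqr_ge0.
  have h1 : 0 <= dot r r by rewrite /dot addr_ge0 // -expr2 sqr_ge0.
  have : dot r r = (l ^+ 2 + k ^+ 2)%:~R.
    by rewrite -(sqr_sqrtr h1) -(sqr_sqrtr h0) -hr.
  rewrite /sqn /dot -!expr2 => ->.
  have -> : l ^+ 2 + k ^+ 2 = n%:Z by rewrite /n; lia.
  by [].
rewrite hn; have inv := dft_inversion (R := R) q0 Aq (A2 `|k| `|l|).
have E (j : 'I_q) : expi (2 * pi * j%:R / q%:R * n%:R) = omega q ^+ (j * n) :> R[i].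
  by rewrite omegaX natrM; congr expi; ring.
under eq_bigr do rewrite E.
by rewrite inv mulr0.
Qed.

Lemma measurable_sieved_gauss : measurable_fun setT (fun x => Normc.normc (f x)).
Proof.
have [/measurable_int/measurable_EFinP mR /measurable_int/measurable_EFinP mI] := sieved_gauss_integrable.
under eq_fun do rewrite normcRI.
apply: measurableT_comp.
  by apply: continuous_measurable_fun; exact: sqrt_continuous.
by apply: measurable_funD; exact: measurable_funX.
Qed.
End Test.

(** * The quotient of the norms of the sieved Gaussian *)

Section PowR.
Context {R : realType}.

Lemma powR_expR (x a : R) : expR x `^ a = expR (a * x).
Proof. by rewrite /powR gt_eqF ?expR_gt0 // expRK. Qed.

Lemma powRD_le4 (a b p : R) : 0 <= a -> 0 <= b -> 0 <= p -> p <= 2 ->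
  (a + b) `^ p <= 4 * (a `^ p + b `^ p).
Proof.
move=> a0 b0 p0 p2.
wlog ab : a b a0 b0 / a <= b.
  move=> W; have [/W|/ltW /W] := leP a b; first exact.
  by rewrite addrC [b `^ p + _]addrC; apply.
apply: (@le_trans _ _ ((2 * b) `^ p)).
  by rewrite ge0_ler_powR ?nnegrE ?addr_ge0 ?mulr_ge0 //; lra.
rewrite powRM //.
have h4 : 2 `^ p <= 4 :> R.
  apply: (le_trans (ler_powR _ p2)); first lra.
  by rewrite powR_mulrn // expr2; lra.
apply: ler_pM; rewrite ?powR_ge0 //.
by rewrite lerDr powR_ge0.
Qed.

(** By cases on r <= l.  With l a Gaussian this bounds an L^p norm by a weighted L^2
    norm. *)
Lemma powR_young (r l p : R) : 0 <= r -> 0 < l -> 0 <= p -> p <= 2 ->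
  r `^ p <= l `^ p + l `^ (p - 2) * r ^+ 2.
Proof.
move=> r0 l0 p0 p2; have [rl|lr] := leP r l.
  apply: (@le_trans _ _ (l `^ p)); last by rewrite lerDl mulr_ge0 ?powR_ge0 ?sqr_ge0.
  by rewrite ge0_ler_powR ?nnegrE // ltW.
have rp : 0 < r := lt_trans l0 lr.
apply: (@le_trans _ _ (l `^ (p - 2) * r ^+ 2)); last by rewrite lerDr powR_ge0.
have -> : r `^ p = r `^ (p - 2) * r ^+ 2.
  by rewrite -powR_mulrn // -powRD ?subrK // (gt_eqF rp) implybT.
rewrite ler_wpM2r ?sqr_ge0 //.
have -> : p - 2 = - (2 - p) by ring.
rewrite !powRN lef_pV2 ?posrE ?powR_gt0 //.
by rewrite ge0_ler_powR ?nnegrE ?subr_ge0 // ?ltW.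
Qed.
End PowR.

Section Bounds.
Context {R : realType}.
Local Notation mu2 := (@lebesgue_measure R \x @lebesgue_measure R)%E.
Variables (q : nat) (A : pred nat).
Hypothesis q0 : (0 < q)%N.
Variables (e p L : R).
Hypothesis e0 : 0 < e.
Hypothesis eq' : e <= (q%:R)^-1.
Hypothesis p1 : 1 <= p.
Hypothesis p2 : p < 2.
Hypothesis L0 : 0 < L.
(** The first condition on the density makes the diagonal part of the remainder small,
    the second keeps the concentrated Gaussian large.  The conditions on e make the rest
    negligible: in this order, the off-diagonal part of the remainder, the L^p norm of the
    concentrated Gaussian, and the remainder near the origin. *)
Hypothesis sL : density q A <= L ^+ 2.
Hypothesis s2 : density q A <= 2^-1 :> R.
Hypothesis eL : 5 * q%:R ^+ 7 * e <= L ^+ 2.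
Hypothesis epL : e `^ (2 - p) <= L `^ p.
Hypothesis e8 : 8 * q%:R ^+ 2 * e <= 1.
Local Notation f := (sieved_gauss q A e).

(* exp (b |x|^2) is the power p - 2 of exp (- pi / 5 e |x|^2); the 5 is the upper bound of
   [wden], which keeps the weighted squares integrable *)
Let b : R := (2 - p) * (pi / 5 * e).

Lemma sieved_gauss_le x : Normc.normc (f x) <=
  e^-1 * expR (- (pi / e * sqn x)) + Normc.normc (remainder A q0 e x).
Proof.
rewrite (sieved_gaussE A q0 e0) (le_trans (ler_normcD _ _)) // lerD2r.
have s0 := density_ge0 (R := R) q A; have s1 := s2.
rewrite normcRI /= expr0n addr0 sqrtr_sqr ger0_norm; last first.
  by rewrite mulr_ge0 ?expR_ge0 // divr_ge0 ?(ltW e0) //; lra.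
rewrite ler_wpM2r ?expR_ge0 // ler_piMl ?invr_ge0 ?(ltW e0) //; lra.
Qed.

(** [powR_young] with l = L exp (- pi / 5 e |x|^2) bounds the p-th power of the remainder
    by a Gaussian of integral of order L^p / e and by L^(p - 2) times a weighted square,
    whose integral is of order L^2 / e by [remainder_sqr_int].  The p-th power of the
    concentrated Gaussian has integral of order e^(1 - p), which is smaller. *)
Lemma sieved_gauss_Lp_le : (LnormC p%:E f <= ((32 * (L `^ p / e)) `^ p^-1)%:E)%E.
Proof.
have hp1 := p1; have hp2 := p2; have p0 : 0 < p by lra.
have pi0 := pi_gt0 R.
have b0 : 0 <= b by rewrite /b !mulr_ge0 ?divr_ge0 ?(ltW e0) ?(ltW pi0) //; lra.
have b5 : 5 * b <= pi * e.
  rewrite /b; have -> : 5 * ((2 - p) * (pi / 5 * e)) = (2 - p) * (pi * e) by field.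
  by rewrite ler_piMl ?mulr_ge0 ?(ltW e0) ?(ltW pi0) //; lra.
have [ir Ir] := @remainder_sqr_int R q A q0 e e0 eq' b b0 b5.
have ip0 : 0 < pi / e by rewrite divr_gt0.
have a1 : 0 < p * (pi / e) by rewrite mulr_gt0.
have a2 : 0 < p * (pi / 5 * e) by rewrite !mulr_gt0 // divr_gt0.
have [i1 I1] := gauss2_int a1; have [i2 I2] := gauss2_int a2.
pose H x := 4 * ((e^-1) `^ p * expR (- (p * (pi / e) * sqn x)) +
   (L `^ p * expR (- (p * (pi / 5 * e) * sqn x)) +
   L `^ (p - 2) * (Normc.normc (remainder A q0 e x) ^+ 2 * expR (b * sqn x)))).
have j1 := RintegrableZl ((e^-1) `^ p) i1.
have j2 := RintegrableZl (L `^ p) i2.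
have j3 := RintegrableZl (L `^ (p - 2)) ir.
have j23 := RintegrableD j2 j3.
have j123 := RintegrableD j1 j23.
have IH : \int[mu2]_x H x = 4 * ((e^-1) `^ p * (pi / (p * (pi / e))) +
   (L `^ p * (pi / (p * (pi / 5 * e))) +
   L `^ (p - 2) * \int[mu2]_x (Normc.normc (remainder A q0 e x) ^+ 2 * expR (b * sqn x)))).
  rewrite /H RintegralZl // RintegralD // RintegralD // !RintegralZl //.
  by rewrite I1 I2.
apply: (@Lnorm_le_dominated _ _ _ mu2 _ H) => //.
- by move=> x; exact: normc_ge0.
- exact: measurable_sieved_gauss.
- move=> x.
  have g0 : 0 <= e^-1 * expR (- (pi / e * sqn x)) by rewrite mulr_ge0 ?expR_ge0 ?invr_ge0 // ltW.
  have n0 := normc_ge0 (remainder A q0 e x).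
  apply: (@le_trans _ _ ((e^-1 * expR (- (pi / e * sqn x)) + Normc.normc (remainder A q0 e x)) `^ p)).
    by rewrite ge0_ler_powR ?nnegrE ?normc_ge0 ?addr_ge0 ?sieved_gauss_le // ltW.
  apply: (le_trans (powRD_le4 g0 n0 (ltW p0) (ltW p2))).
  rewrite /H ler_pM2l // lerD //.
    by rewrite powRM ?expR_ge0 ?invr_ge0 ?(ltW e0) // powR_expR mulrN !mulrA.
  have l0 : 0 < L * expR (- (pi / 5 * e * sqn x)) by rewrite mulr_gt0 ?expR_gt0.
  apply: (le_trans (powR_young n0 l0 (ltW p0) (ltW p2))).
  rewrite !powRM ?expR_ge0 ?(ltW L0) // !powR_expR.
  have -> : p * - (pi / 5 * e * sqn x) = - (p * (pi / 5 * e) * sqn x) by ring.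
  have -> : (p - 2) * - (pi / 5 * e * sqn x) = b * sqn x by rewrite /b; ring.
  by rewrite lerD2l -[leLHS]mulrA [expR _ * _]mulrC.
- exact: RintegrableZl.
rewrite IH.
have Lp0 : 0 < L `^ p by rewrite powR_gt0.
have t1 : (e^-1) `^ p * (pi / (p * (pi / e))) <= L `^ p / e.
  have -> : pi / (p * (pi / e)) = e / p.
    by move: (pi : R) pi0 => P P0; field; rewrite !gt_eqF.
  have E1 : (e^-1) `^ p = e `^ (2 - p) / e ^+ 2.
    rewrite -powR_mulrn ?(ltW e0) // -powRB ?(gt_eqF e0) ?implybT //.
    have -> : 2 - p - 2 = - p by ring.
    by rewrite -powR_inv1 ?(ltW e0) // -powRrM mulN1r.
  rewrite E1; apply: (@le_trans _ _ (L `^ p / e ^+ 2 * (e / 1))).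
    apply: ler_pM; rewrite ?divr_ge0 ?powR_ge0 ?sqr_ge0 ?(ltW e0) ?(ltW p0) //.
      by rewrite ler_wpM2r ?invr_ge0 ?sqr_ge0.
    by rewrite ler_wpM2l ?(ltW e0) // lef_pV2 ?posrE.
  by rewrite le_eqVlt; apply/orP; left; apply/eqP; field; rewrite gt_eqF.
have t2 : L `^ p * (pi / (p * (pi / 5 * e))) <= 5 * (L `^ p / e).
  have -> : pi / (p * (pi / 5 * e)) = 5 / e / p.
    by move: (pi : R) pi0 => P P0; field; rewrite !gt_eqF.
  have -> : 5 * (L `^ p / e) = L `^ p * (5 / e) by ring.
  rewrite ler_wpM2l ?(ltW Lp0) // ler_piMr ?divr_ge0 ?(ltW e0) //.
  by rewrite invf_le1.
have t3 : L `^ (p - 2) * \int[mu2]_x (Normc.normc (remainder A q0 e x) ^+ 2 * expR (b * sqn x))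
    <= 2 * (L `^ p / e).
  have E2 : L `^ p = L `^ (p - 2) * L ^+ 2.
    by rewrite -powR_mulrn ?(ltW L0) // -powRD ?subrK // (gt_eqF L0) implybT.
  have -> : 2 * (L `^ p / e) = L `^ (p - 2) * (2 * L ^+ 2 / e) by rewrite E2; ring.
  rewrite ler_wpM2l ?powR_ge0 //; apply: (le_trans Ir).
  by rewrite ler_pdivlMr // mulrDl divfK ?gt_eqF //; have := sL; have := eL; lra.
lra.
Qed.

(* |x|^2 <= e / 8 on this square, so that the concentrated Gaussian keeps at least half of
   its height *)
Let h : R := Num.sqrt e / 4.
Let Q : set (R * R) := `[- h, h] `*` `[- h, h].

Lemma box_measure : mu2 Q = (e / 4)%:E.
Proof.
have h0 : 0 < h by rewrite /h divr_gt0 // sqrtr_gt0.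
have mI : @lebesgue_measure R [set` `[- h, h]] = (h + h)%:E.
  by rewrite lebesgue_measure_itv /= lte_fin ifT -?EFinB ?opprK //; lra.
pose I : set R := [set` `[- h, h]].
transitivity (@lebesgue_measure R I * @lebesgue_measure R I)%E.
  by apply: product_measure1E; exact: measurable_itv.
rewrite /I mI -EFinM; congr EFin.
have -> : (h + h) * (h + h) = 4 * h ^+ 2 by ring.
by rewrite /h expr_div_n sqr_sqrtr ?(ltW e0) //; field.
Qed.

(** Near the origin the concentrated Gaussian has height of order 1 / e, whereas the
    remainder is bounded independently of e. *)
Lemma sieved_gauss_ge x : Q x -> (8 * e)^-1 <= Normc.normc (f x).
Proof.
move=> [] /= ; rewrite !in_itv /= -!ler_norml => x1 x2.
have h2 : h ^+ 2 = e / 16 by rewrite /h expr_div_n sqr_sqrtr ?(ltW e0) //; field.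
have n2 (y : R) : `|y| <= h -> y ^+ 2 <= e / 16.
  by move=> yh; rewrite -h2 -real_normK ?num_real // lerXn2r ?nnegrE // (le_trans _ yh).
have S8 : sqn x <= e / 8 by have := n2 _ x1; have := n2 _ x2; rewrite /sqn; lra.
have s0 := density_ge0 (R := R) q A; have s1 := s2.
have pi4 : pi <= 4 :> R.
  by have := pihalf_lt2 R; lra.
have ex : 2^-1 <= expR (- (pi / e * sqn x)).
  apply: (@le_trans _ _ (1 + - (pi / e * sqn x))); last exact: expR_ge1Dx.
  have : pi / e * sqn x <= pi / e * (e / 8).
    by rewrite ler_wpM2l // divr_ge0 ?pi_ge0 // ltW.
  have -> : pi / e * (e / 8) = pi / 8 :> R.
    by move: (pi : R) => P; field; rewrite gt_eqF.
  lra.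
set g := (1 - density q A) / e * expR (- (pi / e * sqn x)).
have ei : 0 < e^-1 by rewrite invr_gt0.
have g4 : (4 * e)^-1 <= g.
  have -> : (4 * e)^-1 = 2^-1 / e * 2^-1 by field; rewrite gt_eqF.
  apply: ler_pM => //; first by rewrite mulr_ge0 ?(ltW ei).
  by rewrite ler_wpM2r ?(ltW ei) //; lra.
have r2 := @remainder_le R q A q0 e e0 x.
have q8 : q%:R ^+ 2 <= (8 * e)^-1.
  by rewrite -[leRHS]mul1r ler_pdivlMr ?mulr_gt0 // mulrA [_ * 8]mulrC.
have : g <= Normc.normc (f x) + Normc.normc (remainder A q0 e x).
  have fE := sieved_gaussE A q0 e0 x; rewrite -/g in fE.
  have -> : g = Normc.normc (f x - remainder A q0 e x).
    rewrite fE addrK normcRI /= expr0n addr0 sqrtr_sqr ger0_norm //.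
    by apply: le_trans g4; rewrite invr_ge0 mulr_ge0 // ltW.
  apply: (le_trans (ler_normcD _ _)); rewrite lerD2l.
  by rewrite !normcRI cReN cImN !sqrrN.
have -> : (8 * e)^-1 = (4 * e)^-1 - (8 * e)^-1 by field; rewrite gt_eqF.
lra.
Qed.

Lemma sieved_gauss_conj_ge :
  (((8 * e)^-1 * (e / 4) `^ (1 - p^-1))%:E <= LnormC (hoelder_conjugate p%:E) f)%E.
Proof.
apply: (@Lnorm_conj_ge _ _ _ mu2 _ p _ _ Q) => //.
- by rewrite invr_gt0 mulr_gt0.
- by rewrite divr_gt0.
- by move=> x; exact: normc_ge0.
- exact: measurable_sieved_gauss.
- by apply: measurableX; exact: measurable_itv.
- exact: box_measure.
- exact: sieved_gauss_ge.
Qed.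

(** Both norms are of order e^(- 1 / p), so e drops out of the quotient. *)
Lemma sieved_gauss_ratio :
  ((1024 * L)^-1%:E <= LnormC (hoelder_conjugate p%:E) f / LnormC p%:E f)%E.
Proof.
have hp1 := p1; have hp2 := p2; have p0 : 0 < p by lra.
have pV0 : 0 <= p^-1 by rewrite invr_ge0 ltW.
have pV1 : p^-1 <= 1 by rewrite invf_le1.
pose E : R := (e^-1) `^ p^-1.
have E0 : 0 < E by rewrite powR_gt0 // invr_gt0.
have up : (LnormC p%:E f <= (32 * L * E)%:E)%E.
  apply: (le_trans sieved_gauss_Lp_le); rewrite lee_fin mulrA powRM ?invr_ge0 ?(ltW e0) //; last first.
    by rewrite mulr_ge0 ?powR_ge0.
  rewrite -/E ler_wpM2r ?(ltW E0) // powRM ?powR_ge0 // -powRrM mulfV ?gt_eqF // powRr1 ?(ltW L0) //.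
  by rewrite ler_wpM2r ?(ltW L0) // ler1_powR //; lra.
have lo : ((E / 32)%:E <= LnormC (hoelder_conjugate p%:E) f)%E.
  apply: le_trans sieved_gauss_conj_ge; rewrite lee_fin powRM ?(ltW e0) //.
  have e1E : e `^ (1 - p^-1) = e * E.
    rewrite powRB ?(gt_eqF e0) ?implybT // powRr1 ?(ltW e0) //; congr (_ * _).
    by rewrite /E -[e^-1]powR_inv1 ?(ltW e0) // -powRrM mulN1r powRN.
  rewrite e1E.
  have -> : (8 * e)^-1 * (e * E * 4^-1 `^ (1 - p^-1)) = E / 8 * 4^-1 `^ (1 - p^-1).
    by field; rewrite gt_eqF.
  have : 4^-1 <= 4^-1 `^ (1 - p^-1) :> R.
    by apply: ger1_powR; [apply/andP; split; lra|lra].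
  move: (_ `^ (1 - _)) => t ht; have -> : E / 32 = E / 8 * 4^-1 by field.
  by rewrite ler_wpM2l // divr_ge0 // ltW.
have B0 : 0 < 32 * L * E by rewrite !mulr_gt0.
have -> : ((1024 * L)^-1%:E = (E / 32)%:E * ((32 * L * E)%:E)^-1)%E.
  rewrite inver gt_eqF // -EFinM; congr EFin; field.
  by rewrite !gt_eqF.
apply: lee_pmul => //.
- by rewrite lee_fin divr_ge0 // ltW.
- by rewrite inve_ge0 lee_fin ltW.
- by rewrite lee_pV2 // inE ?Lnorm_ge0 //= lee_fin ltW.
Qed.

Lemma sieved_gauss_neq0 : f 0 != 0.
Proof.
have h0 : 0 < h by rewrite /h divr_gt0 // sqrtr_gt0.
have : Q 0 by split; rewrite /= in_itv /=; lra.
move/sieved_gauss_ge; apply: contraTneq => ->.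
by rewrite Normc.normc0 -ltNge invr_gt0 mulr_gt0.
Qed.
End Bounds.

Lemma parameter_exists (R : realType) (q : nat) (p L : R) : (0 < q)%N -> p < 2 -> 0 < L ->
  exists2 e : R, 0 < e & [/\ e <= q%:R^-1, 5 * q%:R ^+ 7 * e <= L ^+ 2,
    e `^ (2 - p) <= L `^ p & 8 * q%:R ^+ 2 * e <= 1].
Proof.
move=> q0 p2 L0; have qp : 0 < q%:R :> R by rewrite ltr0n.
pose e1 : R := q%:R^-1; pose e2 : R := L ^+ 2 / (5 * q%:R ^+ 7).
pose e3 : R := (L `^ p) `^ (2 - p)^-1; pose e4 : R := (8 * q%:R ^+ 2)^-1.
have [h1 h2 h3 h4] : [/\ 0 < e1, 0 < e2, 0 < e3 & 0 < e4].
  by rewrite /e1 /e2 /e3 /e4 !powR_gt0 // invr_gt0 divr_gt0 ?invr_gt0 ?mulr_gt0 ?exprn_gt0.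
pose e := Num.min (Num.min e1 e2) (Num.min e3 e4).
have e0 : 0 < e by rewrite !lt_min h1 h2 h3 h4.
have [l1 l2 l3 l4] : [/\ e <= e1, e <= e2, e <= e3 & e <= e4].
  by rewrite /e !ge_min !lexx ?orbT.
exists e => //; split => //.
- by rewrite mulrC -ler_pdivlMr // mulr_gt0 // exprn_gt0.
- have -> : L `^ p = e3 `^ (2 - p).
    by rewrite /e3 -powRrM mulVf ?powRr1 ?powR_ge0 // subr_eq0 gt_eqF.
  by rewrite ge0_ler_powR ?nnegrE ?(ltW e0) ?(ltW h3) // subr_ge0 ltW.
- by rewrite mulrC -ler_pdivlMr ?mul1r // mulr_gt0 // exprn_gt0.
Qed.

(** * The sequence *)

Lemma exists_large_ratio (R : realType) (p : R) (n : nat) : 1 <= p -> p < 2 ->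
  exists f : R * R -> R[i], [/\ schwartz f, X2 f, exists x, f x != 0 &
    (n.+1%:R%:E <= LnormC (hoelder_conjugate p%:E) f / LnormC p%:E f)%E].
Proof.
move=> p1 p2; pose N : R := n.+1%:R.
have N1 : 1 <= N by rewrite ler1n.
pose L : R := (1024 * N)^-1.
have L0 : 0 < L by rewrite invr_gt0; lra.
have L1 : L <= 2^-1 by rewrite lef_pV2 ?posrE; lra.
have [q [A [q0 Aq A2 Ad]]] := @periodic_sieve R (L ^+ 2) (exprn_gt0 2 L0).
have dA : density q A <= L ^+ 2 by rewrite /density ler_pdivrMr // ltr0n.
have dA2 : density q A <= 2^-1 :> R by nra.
have [e e0 [e1 e2 e3 e4]] := parameter_exists q0 p2 L0.
exists (sieved_gauss q A e); split.
- exact: sieved_gauss_schwartz.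
- exact: sieved_gauss_X2.
- by exists 0; exact: (sieved_gauss_neq0 q0 e0 dA2 e4).
- have K (c : R) : 0 < c -> (c * (c * N)^-1)^-1 = N.
    by move=> c0; rewrite invfM invrK mulKf // gt_eqF.
  have c0 : 0 < 1024 :> R by lra.
  have LN : (1024 * L)^-1 = N := K _ c0.
  have := sieved_gauss_ratio q0 e0 e1 p1 p2 L0 dA dA2 e2 e3 e4.
  by rewrite LN; exact: id.
Qed.

Theorem lemma3 (R : realType) (p : R) (hp1 : 1 <= p) (hp2 : p < 2) :
  exists f : nat -> R * R -> R[i],
    (forall n : nat,
       [/\ schwartz (f n), X2 (f n) & exists x, f n x != 0]) /\
    (LnormC (hoelder_conjugate p%:E) (f n) / LnormC p%:E (f n))%E
      @[n --> \oo] --> +oo%E.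
Proof.
have /choice[f hf] := fun n => @exists_large_ratio R p n hp1 hp2.
exists f; split; first by move=> n; have [] := hf n.
apply/cvgeyPge => M; near=> n.
have [_ _ _] := hf n; apply: le_trans; rewrite lee_fin.
apply: (@le_trans _ _ n%:R); last by rewrite ler_nat.
by near: n; exact: nbhs_infty_ger.
Unshelve. all: by end_near. Qed.
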